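(* Let $\mathbb{D}$ be a skew field, $d\ge 2$, and let $(V,\mathcal{P},\mathcal{B})$ be a $\mathrm{TD}(3,n)$ which lies on the hyperplanes $H_1,H_2,H_3$ of $P^d(\mathbb{D})$, where $\dim(H_1\cap H_2\cap H_3)=d-3$. Choose points $1_1\in H_1\cap V$ and $1_2\in H_2\cap V$, let $1_3$ be the point of $H_3\cap V$ on the block through $1_1$ and $1_2$, and choose homogeneous coordinates such that $1_1=[0,1,1,\boldsymbol{o}]$, $1_2=[1,0,1,\boldsymbol{o}]$, $1_3=[-1,1,0,\boldsymbol{o}]$, and such that $H_1,H_2,H_3$ have equations $x_1=0$, $x_2=0$, $x_3=0$, respectively. Then there exists a subgroup $G$ of $\mathbb{D}^*\ltimes\mathbb{D}^{d-2}$ of order $n$ such that $$H_1\cap V=\{[0,\gamma,1,\boldsymbol{x}] : (\gamma,\boldsymbol{x})\in G\},\quad H_2\cap V=\{[\gamma,0,1,\boldsymbol{x}] : (\gamma,\boldsymbol{x})\in G\},\quad H_3\cap V=\{[-1,\gamma,0,\boldsymbol{x}] : (\gamma,\boldsymbol{x})\in G\}. \qquad ( * )$$ The group $G$ depends only on the choice of coordinates. For any two such choices (of $1_1$, $1_2$ and coordinates), the two groups $G_1$ and $G_2$ so obtained satisfy $G_1=(a,\boldsymbol{v})\cdot\phi_T G_2\cdot(a,\boldsymbol{v})^{-1}$ for some $(a,\boldsymbol{v})\in\mathbb{D}^*\ltimes\mathbb{D}^{d-2}$ and $T\in GL_{d-2}(\mathbb{D})$. Conversely, given any subgroup $G$ of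 $\mathbb{D}^*\ltimes\mathbb{D}^{d-2}$ of order $n\ge 3$, $( * )$ gives an embedding of a $\mathrm{TD}(3,n)$ on the hyperplanes $H_1,H_2,H_3$ with equations $x_1=0$, $x_2=0$, $x_3=0$, respectively; that is, the three sets on the right-hand sides of $( * )$ are the parts, and the collinear triples consisting of one point from each of these three sets are the blocks, of a $\mathrm{TD}(3,n)$ lying on $H_1,H_2,H_3$.
   Context: A transversal design $\mathrm{TD}(k,n)$, with $n\ge 3$, $k\ge 3$, is a triple $(V,\mathcal{P},\mathcal{B})$ where $V$ is a set of size $kn$, $\mathcal{P}$ is a partition of $V$ into $k$ subsets of size $n$ (called parts), and $\mathcal{B}$ is a set of $k$-subsets of $V$ (called blocks), such that any two distinct elements of $V$ are contained in either a unique part or a unique block, but not both. For a skew field $\mathbb{D}$, $\mathbb{D}^*=\mathbb{D}\setminus\{0\}$, and $\mathbb{D}^{m}$ is regarded as a right vector space: $(x_1,\dots,x_m)\alpha=(x_1\alpha,\dots,x_m\alpha)$. Matrices in $GL_m(\mathbb{D})$ act on the left of column vectors. $P^d(\mathbb{D})$ is the $d$-dimensional projective space of one-dimensional subspaces of the right vector space $\mathbb{D}^{d+1}$; $[x_1,\dots,x_{d+1}]$ denotes the point with those homogeneous coordinates (with respect to some basis of $\mathbb{D}^{d+1}$; a choice of homogeneous coordinates means a choice of basis). Here $[\alpha,\beta,\gamma,\boldsymbol{x}]$ has $\alpha,\beta,\gamma\in\mathbb{D}$, $\boldsymbol{x}\in\mathbb{D}^{d-2}$, and $\boldsymbol{o}$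 is the zero vector of $\mathbb{D}^{d-2}$. Hyperplanes are $(d-1)$-flats, with equations $\alpha_1x_1+\dots+\alpha_{d+1}x_{d+1}=0$, not all $\alpha_i=0$. Dimension is projective dimension (a $(-1)$-flat is empty). A $\mathrm{TD}(3,n)$ $(V,\mathcal{P},\mathcal{B})$ lies on (is embedded on) the hyperplanes $H_1,H_2,H_3$ of $P^d(\mathbb{D})$ if $V\subseteq P^d(\mathbb{D})$, the hyperplanes $H_1,H_2,H_3$ are distinct, $\mathcal{P}=\{V\cap H_1,V\cap H_2,V\cap H_3\}$, every block $B$ is contained in a line $\ell_B$ of $P^d(\mathbb{D})$, the lines $\ell_B$ ($B\in\mathcal{B}$) are distinct, and no $\ell_B$ is contained in any $H_i$. $\mathbb{D}^*\ltimes\mathbb{D}^{d-2}$ denotes the group with underlying set $\mathbb{D}^*\times\mathbb{D}^{d-2}$ and operation $(\alpha,\boldsymbol{x})\cdot(\beta,\boldsymbol{y})=(\alpha\beta,\boldsymbol{x}\beta+\boldsymbol{y})$. For $T\in GL_{d-2}(\mathbb{D})$, $\phi_T$ is the automorphism $(\gamma,\boldsymbol{x})\mapsto(\gamma,T\boldsymbol{x})$ of $\mathbb{D}^*\ltimes\mathbb{D}^{d-2}$, and $\phi_TG_2$ is the image of $G_2$ under $\phi_T$. *)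

(* Defs.v *)
From HB Require Import structures.
From mathcomp Require Import all_boot all_order all_algebra.
From mathcomp Require Import boolp classical_sets functions cardinality.

Set Implicit Arguments.
Unset Strict Implicit.
Unset Printing Implicit Defensive.

Import GRing.Theory.
Local Open Scope classical_set_scope.
Local Open Scope ring_scope.

HB.mixin Record UnitRing_isSkewField D of GRing.UnitRing D := {
  skew_unitP : forall x : D, x != 0 -> x \is a GRing.unit
}.

#[short(type="skewFieldType")]
HB.structure Definition SkewField :=
  {D of UnitRing_isSkewField D & GRing.UnitRing D}.

Definition joining {T : Type} (S : set (set T)) (x y : T) : set (set T) :=
  [set X | [/\ S X, X x & X y]].

Definition transversal_design {T : Type} (k n : nat)
    (V : set T) (P Bl : set (set T)) : Prop :=
  [/\ (3 <= n)%N /\ (3 <= k)%N,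
      (V #= `I_(k * n))%card,
      [/\ partition P id V, (P #= `I_k)%card &
          forall X, P X -> (X #= `I_n)%card],
      forall B, Bl B -> B `<=` V /\ (B #= `I_k)%card &
      forall x y, V x -> V y -> x <> y ->
        ((exists! X, joining P x y X) /\ ~ (exists B, joining Bl x y B)) \/
        ((exists! B, joining Bl x y B) /\ ~ (exists X, joining P x y X))].

(* D^m is the right vector space 'cV[D]_m.  As v *m a%:M has entries v i 0 * a,
   a family of r vectors is a matrix C : 'M_(m, r) with these vectors as
   columns, and C *m x is their combination with right coefficients x. *)
Definition rspan {D : skewFieldType} {m r : nat} (C : 'M[D]_(m, r)) :
    set 'cV[D]_m :=
  range (fun x : 'cV[D]_r => C *m x).

Definition rfree {D : skewFieldType} {m r : nat} (C : 'M[D]_(m, r)) : Prop :=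
  forall x : 'cV[D]_r, C *m x = 0 -> x = 0.

Definition rbasis {D : skewFieldType} {m : nat} (b : 'M[D]_m) : Prop :=
  rfree b /\ rspan b = [set: 'cV[D]_m].

Definition GL {D : skewFieldType} {m : nat} (A : 'M[D]_m) : Prop :=
  exists B : 'M[D]_m, A *m B = 1%:M /\ B *m A = 1%:M.

(* A point is the set of vectors of a one-dimensional subspace. *)
Definition proj_space {D : skewFieldType} {d : nat} :
    set (set 'cV[D]_d.+1) :=
  [set p | exists2 v : 'cV[D]_d.+1, rfree v & p = rspan v].

(* k is the projective dimension. *)
Definition flat {D : skewFieldType} {d : nat} (k : int)
    (F : set (set 'cV[D]_d.+1)) : Prop :=
  exists (r : nat) (C : 'M[D]_(d.+1, r)),
    [/\ k = r%:Z - 1, rfree C &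
        F = [set p | proj_space p /\ p `<=` rspan C]].

Definition line {D : skewFieldType} {d : nat}
  (l : set (set 'cV[D]_d.+1)) : Prop := flat 1 l.

Definition hyperplane {D : skewFieldType} {d : nat}
  (H : set (set 'cV[D]_d.+1)) : Prop := flat (d%:Z - 1) H.

Definition collinear {D : skewFieldType} {d : nat}
  (S : set (set 'cV[D]_d.+1)) : Prop := exists2 l, line l & S `<=` l.

Definition lies_on {D : skewFieldType} {d : nat}
    (V : set (set 'cV[D]_d.+1)) (P Bl : set (set (set 'cV[D]_d.+1)))
    (H1 H2 H3 : set (set 'cV[D]_d.+1)) : Prop :=
  [/\ V `<=` proj_space,
      [/\ hyperplane H1, hyperplane H2 & hyperplane H3],
      [/\ H1 <> H2, H1 <> H3 & H2 <> H3],
      P = [set V `&` H1; V `&` H2; V `&` H3] &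
      exists l : set (set 'cV[D]_d.+1) -> set (set 'cV[D]_d.+1),
        set_inj Bl l /\
        forall B, Bl B ->
          [/\ line (l B), B `<=` l B &
              [/\ ~ (l B `<=` H1), ~ (l B `<=` H2) & ~ (l B `<=` H3)]]].

(* The point with homogeneous coordinates x with respect to the basis formed
   by the columns of b. *)
Definition hpoint {D : skewFieldType} {d : nat} (b : 'M[D]_d.+1)
    (x : 'cV[D]_d.+1) : set 'cV[D]_d.+1 :=
  rspan (b *m x).

(* (alpha, beta, gamma, x) as a vector of D^(d+1); meaningful for 2 <= d. *)
Definition hcoord {D : skewFieldType} {d : nat} (alpha beta gamma : D)
    (x : 'cV[D]_d.-2) : 'cV[D]_d.+1 :=
  \col_(i < d.+1)
    nth 0 [:: alpha, beta, gamma & [seq x j 0 | j <- enum 'I_d.-2]] i.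

(* The hyperplane x_{i+1} = 0: coordinates are numbered from 0 here. *)
Definition coord_hyperplane {D : skewFieldType} {d : nat} (b : 'M[D]_d.+1)
    (i : nat) : set (set 'cV[D]_d.+1) :=
  [set p | exists x : 'cV[D]_d.+1,
             [/\ x != 0, x (inord i) 0 = 0 & p = hpoint b x]].

Record semidirect (D : skewFieldType) (m : nat) := Semidirect {
  sd_val :> D * 'cV[D]_m;
  sd_valP : sd_val.1 != 0
}.

HB.instance Definition _ (D : skewFieldType) (m : nat) :=
  [isSub for @sd_val D m].
HB.instance Definition _ (D : skewFieldType) (m : nat) :=
  [Choice of semidirect D m by <:].

Section SemidirectGroup.
Variables (D : skewFieldType) (m : nat).
Implicit Types (g h : semidirect D m) (T : 'M[D]_m).

Let sd_unit g : g.1 \is a GRing.unit.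
Proof. exact: skew_unitP (sd_valP g). Qed.

Lemma sd_one_neq0 : ((1, 0) : D * 'cV[D]_m).1 != 0.
Proof. exact: oner_neq0. Qed.

Lemma sd_mul_neq0 g h :
  ((g.1 * h.1, g.2 *m h.1%:M + h.2) : D * 'cV[D]_m).1 != 0.
Proof.
apply/eqP => /= gh0; move: (sd_valP h).
by rewrite -[h.1](mulKr (sd_unit g)) gh0 mulr0 eqxx.
Qed.

Lemma sd_inv_neq0 g :
  ((g.1^-1, - (g.2 *m (g.1^-1)%:M)) : D * 'cV[D]_m).1 != 0.
Proof.
apply/eqP => /= g0; have := mulrV (sd_unit g).
by rewrite g0 mulr0 => /eqP; rewrite eq_sym oner_eq0.
Qed.

Definition sd_one : semidirect D m := Semidirect sd_one_neq0.
Definition sd_mul g h : semidirect D m := Semidirect (sd_mul_neq0 g h).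
Definition sd_inv g : semidirect D m := Semidirect (sd_inv_neq0 g).

Lemma sd_mulA : associative sd_mul.
Proof.
move=> g h k; apply: val_inj => /=.
by rewrite mulrA mulmxDl -mulmxA -scalar_mxM addrA.
Qed.

Lemma sd_mul1g : left_id sd_one sd_mul.
Proof.
by move=> g; apply: val_inj; rewrite /= mul1r mul0mx add0r -surjective_pairing.
Qed.

Lemma sd_mulg1 : right_id sd_one sd_mul.
Proof.
by move=> g; apply: val_inj; rewrite /= mulr1 mulmx1 addr0 -surjective_pairing.
Qed.

Lemma sd_mulVg : left_inverse sd_one sd_inv sd_mul.
Proof.
move=> g; apply: val_inj => /=.
by rewrite mulVr // mulNmx -mulmxA -scalar_mxM mulVr // mulmx1 addNr.
Qed.

Lemma sd_mulgV : right_inverse sd_one sd_inv sd_mul.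
Proof. by move=> g; apply: val_inj; rewrite /= mulrV // subrr. Qed.

HB.instance Definition _ := isGroup.Build (semidirect D m)
  sd_mulA sd_mul1g sd_mulg1 sd_mulVg sd_mulgV.

Lemma sd_phi_neq0 T g : ((g.1, T *m g.2) : D * 'cV[D]_m).1 != 0.
Proof. exact: sd_valP. Qed.

Definition sd_phi T g : semidirect D m := Semidirect (sd_phi_neq0 T g).

End SemidirectGroup.

Definition subgroup_of_order {gT : groupType} (n : nat) (G : set gT) : Prop :=
  group_closed (mem G) /\ (G #= `I_n)%card.

Section Parts.
Variables (D : skewFieldType) (d : nat).
Variables (b : 'M[D]_d.+1) (G : set (semidirect D d.-2)).

Definition part1 : set (set 'cV[D]_d.+1) :=
  [set hpoint b (hcoord 0 g.1 1 g.2) | g in G].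
Definition part2 : set (set 'cV[D]_d.+1) :=
  [set hpoint b (hcoord g.1 0 1 g.2) | g in G].
Definition part3 : set (set 'cV[D]_d.+1) :=
  [set hpoint b (hcoord (- 1) g.1 0 g.2) | g in G].

Definition collinear_triples : set (set (set 'cV[D]_d.+1)) :=
  [set B | exists p1 p2 p3,
     [/\ part1 p1, part2 p2, part3 p3, B = [set p1; p2; p3] & collinear B]].

End Parts.

Definition third_point {D : skewFieldType} {d : nat}
    (V : set (set 'cV[D]_d.+1)) (Bl : set (set (set 'cV[D]_d.+1)))
    (H3 : set (set 'cV[D]_d.+1)) (p1 p2 p3 : set 'cV[D]_d.+1) : Prop :=
  (H3 `&` V) p3 /\ exists2 B, Bl B & [/\ B p1, B p2 & B p3].

Definition adapted_coordinates {D : skewFieldType} {d : nat}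
    (H1 H2 H3 : set (set 'cV[D]_d.+1)) (p1 p2 p3 : set 'cV[D]_d.+1)
    (b : 'M[D]_d.+1) : Prop :=
  [/\ rbasis b,
      [/\ p1 = hpoint b (hcoord 0 1 1 0), p2 = hpoint b (hcoord 1 0 1 0) &
          p3 = hpoint b (hcoord (- 1) 1 0 0)] &
      [/\ H1 = coord_hyperplane b 0, H2 = coord_hyperplane b 1 &
          H3 = coord_hyperplane b 2]].

Definition coordinate_choice {D : skewFieldType} {d : nat}
    (V : set (set 'cV[D]_d.+1)) (Bl : set (set (set 'cV[D]_d.+1)))
    (H1 H2 H3 : set (set 'cV[D]_d.+1)) (b : 'M[D]_d.+1) : Prop :=
  exists p1 p2 p3, [/\ (H1 `&` V) p1, (H2 `&` V) p2,
    third_point V Bl H3 p1 p2 p3 & adapted_coordinates H1 H2 H3 p1 p2 p3 b].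

Definition parametrizes {D : skewFieldType} {d : nat} (n : nat)
    (V H1 H2 H3 : set (set 'cV[D]_d.+1)) (b : 'M[D]_d.+1)
    (G : set (semidirect D d.-2)) : Prop :=
  subgroup_of_order n G /\
  [/\ H1 `&` V = part1 b G, H2 `&` V = part2 b G & H3 `&` V = part3 b G].

(* Main.v *)
(* Label by (gamma, x) the points [0,gamma,1,x], [gamma,0,1,x], [-1,gamma,0,x] of
   the three hyperplanes.  Points with labels g, h, f on H1, H2, H3 are collinear
   if and only if g = f h.  Let G1, G2, G3 be the sets of labels of the three
   parts.  Through two points of different parts there is a block, so
   G1 G2^-1 <= G3, G3^-1 G1 <= G2 and G3 G2 <= G1; as all three sets contain 1,
   they coincide and form a group.  A change of coordinates preserving the three
   hyperplanes turns a label g on H1 into h phi_T(g) k; since G2 contains 1, h k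
   lies in G1, and G1 = G1 (h k)^-1 is the conjugate of phi_T(G2) by h. *)

Require Import Defs.
From mathcomp Require Import all_boot all_order all_algebra.
From mathcomp Require Import boolp classical_sets functions cardinality.

Import GRing.Theory.
Local Open Scope classical_set_scope.
Local Open Scope ring_scope.

(** * Linear algebra over a skew field *)

(** Scalars do not commute and act on the right, so determinants are out of reach; dimension
    arguments rest instead on one fact, that a free family splits off from the whole space with a
    free complement ([rfree_completion]). The hypothesis that the three hyperplanes meet in
    dimension d - 3 makes their equations independent. This yields a vector killed by the first two
    equations but not by the third, and from it a basis adapted to 1_1, 1_2, 1_3 is assembled. The
    rule g = f h comes from a relation u3 = u1 a + u2 c between coordinate vectors: the third
    coordinate 0 of u3 forces c = -a, and its first coordinate -1 then makes a the inverse of the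
    first component of h. The sign in -1 is what makes the three points with label 1 collinear.
    Labels and points determine each other, so the coordinates determine G, and the order of G is
    the size of a part. *)

Section SkewLinearAlgebra.
Context {D : skewFieldType}.

Lemma skew_mulrV (a : D) : a != 0 -> a * a^-1 = 1.
Proof. by move=> a0; rewrite mulrV ?skew_unitP. Qed.

Lemma skew_mulVr (a : D) : a != 0 -> a^-1 * a = 1.
Proof. by move=> a0; rewrite mulVr ?skew_unitP. Qed.

Lemma skew_mul_eq0 (a b : D) : (a * b == 0) = (a == 0) || (b == 0).
Proof.
apply/eqP/orP => [ab0|[]/eqP->]; rewrite ?mul0r ?mulr0 //.
have [|a0] := eqVneq a 0; [by left|right].
by rewrite -[b]mul1r -(skew_mulVr a a0) -mulrA ab0 mulr0.
Qed.

Lemma skew_inv_eq0 (a : D) : (a^-1 == 0) = (a == 0).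
Proof.
apply/eqP/eqP => [a0|->]; last by rewrite invr0.
by rewrite -[a]invrK a0 invr0.
Qed.

Lemma cV1_scalar (c : 'cV[D]_1) : c = (c 0 0)%:M.
Proof. exact: mx11_scalar. Qed.

Lemma mulmx_scalarE {m} (v : 'cV[D]_m) (a : D) i j :
  (v *m a%:M) i j = v i 0 * a.
Proof. by rewrite mxE big_ord1 !mxE !ord1 eqxx mulr1n. Qed.

Lemma mulmx_scalarK {m} (v : 'cV[D]_m) (a : D) :
  a != 0 -> v *m a%:M *m (a^-1)%:M = v.
Proof. by move=> a0; rewrite -mulmxA -scalar_mxM skew_mulrV ?mulmx1. Qed.

Lemma mulmx_scalarVK {m} (v : 'cV[D]_m) (a : D) :
  a != 0 -> v *m (a^-1)%:M *m a%:M = v.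
Proof. by move=> a0; rewrite -mulmxA -scalar_mxM skew_mulVr ?mulmx1. Qed.

Lemma scalar_mx11_eq0 (a : D) : (a%:M == 0 :> 'M_1) = (a == 0).
Proof.
apply/eqP/eqP => [/matrixP/(_ 0 0)|->]; last by rewrite raddf0.
by rewrite !mxE eqxx.
Qed.

Lemma mulmx_scalar_eq0 {m} (v : 'cV[D]_m) (a : D) :
  (v *m a%:M == 0) = (v == 0) || (a == 0).
Proof.
apply/eqP/orP => [va0|[]/eqP->]; rewrite ?mul0mx ?raddf0 ?mulmx0 //.
have [|a0] := eqVneq a 0; [by right|left].
by rewrite -(mulmx_scalarK v a a0) va0 mul0mx.
Qed.

Lemma rfree_colP {m} (v : 'cV[D]_m) : rfree v <-> v != 0.
Proof.
split=> [fv|v0 x].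
  apply/eqP => v0; have /(_ 1) := fv; rewrite v0 mul0mx => /(_ erefl)/eqP.
  by rewrite scalar_mx11_eq0 oner_eq0.
by rewrite (cV1_scalar x) => /eqP; rewrite mulmx_scalar_eq0 (negPf v0) => /eqP->;
  rewrite raddf0.
Qed.

Lemma rspan_colP {m} (v w : 'cV[D]_m) :
  rspan v w <-> exists a : D, w = v *m a%:M.
Proof.
split=> [[x _ <-]|[a ->]]; last by exists a%:M.
by exists (x 0 0); rewrite -cV1_scalar.
Qed.

Lemma rspan_id {m} (v : 'cV[D]_m) : rspan v v.
Proof. by exists 1; rewrite ?mulmx1. Qed.

Lemma rspan_scale {m} (v : 'cV[D]_m) (a : D) :
  a != 0 -> rspan (v *m a%:M) = rspan v.
Proof.
move=> a0; apply/seteqP; split=> w [x _ <-].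
  by exists (a%:M *m x); rewrite ?mulmxA.
by exists ((a^-1)%:M *m x); rewrite // !mulmxA mulmx_scalarK.
Qed.

Lemma rspan_eqP {m} (u v : 'cV[D]_m) : u != 0 ->
  rspan u = rspan v <-> exists2 a : D, a != 0 & u = v *m a%:M.
Proof.
move=> u0; split=> [uv|[a a0 ->]]; last exact: rspan_scale.
have [a ua] : exists a : D, u = v *m a%:M.
  by apply/rspan_colP; rewrite -uv; exact: rspan_id.
exists a => //; apply: contraNneq u0 => a0.
by rewrite ua a0 raddf0 mulmx0.
Qed.

Lemma rspan_col_sub {m r} (v : 'cV[D]_m) (C : 'M[D]_(m, r)) :
  rspan v `<=` rspan C <-> rspan C v.
Proof.
split=> [|[x _ <-] w [y _ <-]]; first by apply; exact: rspan_id.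
by exists (x *m y); rewrite ?mulmxA.
Qed.

(** The inclusion of the subspace where coordinate [i] vanishes; its transpose deletes coordinate
    [i]. *)
Definition insert_mx {m} (i : 'I_m.+1) : 'M[D]_(m.+1, m) :=
  \matrix_(k, j) (k == lift i j)%:R.

Lemma tr_insert_mxK {m} (i : 'I_m.+1) : (insert_mx i)^T *m insert_mx i = 1%:M.
Proof.
apply/matrixP => j k; rewrite !mxE (bigD1 (lift i j)) //= !mxE eqxx mul1r.
rewrite (inj_eq lift_inj) big1 ?addr0 // => l lj.
by rewrite !mxE (negPf lj) mul0r.
Qed.

Lemma insert_mxK {m} (i : 'I_m.+1) :
  insert_mx i *m (insert_mx i)^T = 1%:M - delta_mx i i.
Proof.
apply/matrixP => k l; rewrite !mxE; case: (unliftP i k) => [j ->|->].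
  rewrite (bigD1 j) //= !mxE eqxx mul1r big1 => [|j' jj']; last first.
    by rewrite !mxE (inj_eq lift_inj) eq_sym (negPf jj') mul0r.
  by rewrite [lift i j == i]eq_sym (negPf (neq_lift i j)) addr0 subr0 eq_sym.
rewrite big1 => [|j _]; last by rewrite !mxE (negPf (neq_lift i j)) mul0r.
by rewrite eqxx /= eq_sym subrr.
Qed.

Lemma insert_mx_coordP {m} (i : 'I_m.+1) (x : 'cV[D]_m.+1) :
  rspan (insert_mx i) x <-> x i 0 = 0.
Proof.
split=> [[y _ <-]|xi].
  by rewrite mxE big1 // => j _; rewrite mxE (negPf (neq_lift i j)) mul0r.
exists ((insert_mx i)^T *m x) => //.
rewrite mulmxA insert_mxK mulmxBl mul1mx -(mul_delta_mx (0 : 'I_1)).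
rewrite -mulmxA -rowE (cV1_scalar (row i x)) !mxE xi raddf0 mulmx0.
by rewrite subr0.
Qed.

(** A nonzero entry of [v] is a pivot: [l] divides that coordinate by the pivot, and [E] clears it
    with [v] and then deletes it. The identities make [v *m l] and [F *m E] complementary
    projections. *)
Lemma col_completion {s} (v : 'cV[D]_s) : v != 0 ->
  exists s' (l : 'rV[D]_s) (E : 'M[D]_(s', s)) (F : 'M[D]_(s, s')),
    [/\ s = s'.+1, l *m v = 1%:M, E *m v = 0, E *m F = 1%:M &
        v *m l + F *m E = 1%:M].
Proof.
move=> v0; have [i vi] : exists i, v i 0 != 0.
  apply/existsP; apply: contraNT v0; rewrite negb_exists => /forallP v0.
  by apply/eqP/colP => i; rewrite mxE; apply/eqP; rewrite -[_ == _]negbK.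
case: s v v0 i vi => [|s] v v0 i vi; first by case: i vi.
pose l := (v i 0)^-1%:M *m delta_mx 0 i : 'rV[D]_s.+1.
have lv : l *m v = 1%:M.
  by rewrite -mulmxA -rowE (cV1_scalar (row i v)) mxE -scalar_mxM skew_mulVr.
have lF : l *m insert_mx i = 0.
  rewrite -mulmxA -rowE; apply/rowP => j; rewrite mxE big_ord1 !mxE.
  by rewrite (negPf (neq_lift i j)) mulr0.
exists s, l, ((insert_mx i)^T *m (1%:M - v *m l)), (insert_mx i); split=> //.
- by rewrite -mulmxA mulmxBl mul1mx -mulmxA lv mulmx1 subrr mulmx0.
- by rewrite -mulmxA mulmxBl mul1mx -mulmxA lF mulmx0 subr0 tr_insert_mxK.
rewrite mulmxA insert_mxK mulmxBl mul1mx.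
(* Row [i] of [v *m l] is already the unit row, because the pivot cancels. *)
suff -> : delta_mx i i *m (1%:M - v *m l) = 0 by rewrite subr0 addrC subrK.
rewrite -(mul_delta_mx (0 : 'I_1)) -mulmxA mulmxBr mulmx1 mulmxA -rowE.
rewrite (cV1_scalar (row i v)) mxE mulmxA -scalar_mxM skew_mulrV //.
by rewrite mul1mx subrr mulmx0.
Qed.

(** Induction on the number of columns: the complement of the last [r] columns is split once more,
    along the image of the first column. The statement replaces rank theory: [s] counts the missing
    basis vectors, [F] supplies them, and [L], [E] read off the coordinates. *)
Lemma rfree_completion {m r} (C : 'M[D]_(m, r)) : rfree C ->
  exists s (L : 'M[D]_(r, m)) (E : 'M[D]_(s, m)) (F : 'M[D]_(m, s)),
    [/\ m = (r + s)%N, L *m C = 1%:M, E *m C = 0, E *m F = 1%:M &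
        C *m L + F *m E = 1%:M].
Proof.
elim: r C => [|r IH] C.
  move=> _; exists m, 0, 1%:M, 1%:M; split; rewrite ?mulmx1 ?mulmx0 ?add0r //.
    by apply/matrixP => -[].
  by apply/matrixP => ? [].
move: C; rewrite -[r.+1]/(1 + r)%N => C freeC.
pose c := lsubmx C; pose C1 := rsubmx C.
have CE : C = row_mx c C1 by rewrite hsubmxK.
have [|s [L [E [F [ms LC EC EF CLFE]]]]] := IH C1.
  move=> x C1x; have : (col_mx 0 x : 'cV_(1 + r)) = 0.
    by apply: freeC; rewrite CE mul_row_col mulmx0 add0r.
  by rewrite -[0 in RHS]col_mx0 => /eq_col_mx[].
(* Otherwise [c] equals [C1 *m (L *m c)], a linear dependence among the columns of [C]. *)
have Ec0 : E *m c != 0.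
  apply/eqP => Ec0; have : (col_mx 1%:M (- (L *m c)) : 'cV_(1 + r)) = 0.
    apply: freeC; rewrite CE mul_row_col mulmx1 mulmxN mulmxA.
    by rewrite -[C1 *m L](addrK (F *m E)) CLFE mulmxBl mul1mx -mulmxA Ec0
      mulmx0 subr0 subrr.
  rewrite -[0 in RHS]col_mx0 => /eq_col_mx[/eqP].
  by rewrite scalar_mx11_eq0 oner_eq0.
have [s' [l [E' [F' [ss' lw E'w E'F' wl]]]]] := col_completion _ Ec0.
(* The coefficient of [c] is read by [l *m E]; the contribution of [c] is then subtracted before [L]
   reads the coefficients of [C1]. *)
exists s', (col_mx (l *m E) (L - L *m c *m l *m E)), (E' *m E), (F *m F').
split.
- by rewrite ms ss' addnS.
- rewrite CE mul_mx_row !mul_col_mx !mulmxBl -!mulmxA EC lw !mulmx0 LC !subr0.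
  rewrite mulmx1 subrr -block_mxEh.
  by rewrite -scalar_mx_block.
- by rewrite CE mul_mx_row -!mulmxA EC E'w mulmx0 row_mx0.
- by rewrite mulmxA -(mulmxA E') EF mulmx1.
rewrite CE mul_row_col mulmxBr !mulmxA -(mulmxA F).
have -> : F' *m E' = 1%:M - E *m c *m l by rewrite -wl addrAC subrr add0r.
rewrite mulmxBr mulmx1 mulmxBl !mulmxA.
have -> : C1 *m L = 1%:M - F *m E by rewrite -CLFE addrK.
rewrite !mulmxBl !mul1mx.
rewrite opprB [X in X + _ = _]addrCA [c *m l *m E + _]addrC subrK addrACA.
by rewrite subrK subrr addr0.
Qed.

Lemma rfree_leq {m r} (C : 'M[D]_(m, r)) : rfree C -> (r <= m)%N.
Proof.
by case/rfree_completion=> s [L [E [F [ms _ _ _ _]]]]; rewrite ms leq_addr.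
Qed.

(** Expressing the standard basis through [C] gives a right inverse [X], whose columns are free, so
    [rfree_leq] applies to [X]. *)
Lemma rspan_leq {m r} (C : 'M[D]_(m, r)) : (forall v, rspan C v) -> (m <= r)%N.
Proof.
move=> spanC; have [X CX] : exists X : 'M[D]_(r, m), C *m X = 1%:M.
  have /choice[f Hf] : forall j : 'I_m, exists x : 'cV[D]_r, C *m x = col j 1%:M.
    by move=> j; have [x _ Cx] := spanC (col j 1%:M); exists x.
  exists (\matrix_(i, j) f j i 0).
  apply/matrixP => i j; have /colP/(_ i) := Hf j; rewrite !mxE => <-.
  by apply: eq_bigr => k _; rewrite mxE.
apply: (@rfree_leq _ _ X) => x Xx.
by rewrite -[x]mul1mx -CX -mulmxA Xx mulmx0.
Qed.

(** For a square matrix the complement has dimension 0, so the left inverse from the completion is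
    two-sided. *)
Lemma rfree_square {m} (C : 'M[D]_m) : rfree C -> GL C.
Proof.
case/rfree_completion=> s [L [E [F [ms LC _ _ CL]]]]; exists L; split=> //.
have s0 : s = 0%N by apply/eqP; rewrite -(eqn_add2l m) addn0 -ms.
move: E F CL; rewrite s0 => E F; rewrite (_ : F *m E = 0) ?addr0 //.
by apply/matrixP => i j; rewrite !mxE big_ord0.
Qed.

Lemma GL_rbasis {m} (C : 'M[D]_m) : GL C -> rbasis C.
Proof.
case=> B [CB BC]; split=> [x Cx|].
  by rewrite -[x]mul1mx -BC -mulmxA Cx mulmx0.
by apply/seteqP; split=> // v _; exists (B *m v); rewrite // mulmxA CB mul1mx.
Qed.

(** The complement has dimension 1, so [E] is a single row, and this row is the equation. *)
Lemma rfree_hyperplane_form {m} (C : 'M[D]_(m.+1, m)) : rfree C ->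
  exists f : 'rV[D]_m.+1, forall v, rspan C v <-> f *m v = 0.
Proof.
case/rfree_completion=> s [L [E [F [ms _ EC _ CL]]]].
have s1 : s = 1%N by apply/eqP; rewrite -(eqn_add2l m) addn1 -ms.
move: E F EC CL; rewrite s1 => E F EC CL; exists E => v; split.
  by case=> x _ <-; rewrite mulmxA EC mul0mx.
move=> Ev; exists (L *m v) => //.
by rewrite mulmxA -[C *m L](addrK (F *m E)) CL mulmxBl -mulmxA Ev mulmx0
  subr0 mul1mx.
Qed.

End SkewLinearAlgebra.

(** * Points, lines and hyperplanes *)

Section Projective.
Context {D : skewFieldType} {d : nat}.
Implicit Types (u v : 'cV[D]_d.+1) (H : set (set 'cV[D]_d.+1)).

Lemma proj_space_rspan v : v != 0 -> proj_space (rspan v).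
Proof. by move=> v0; exists v => //; apply/rfree_colP. Qed.

Lemma proj_spaceP (p : set 'cV[D]_d.+1) :
  proj_space p -> exists2 v : 'cV[D]_d.+1, v != 0 & p = rspan v.
Proof. by case=> v fv ->; exists v => //; apply/rfree_colP. Qed.

Definition ker_points (f : 'rV[D]_d.+1) : set (set 'cV[D]_d.+1) :=
  [set p | exists v : 'cV[D]_d.+1, [/\ v != 0, f *m v = 0 & p = rspan v]].

Lemma ker_points_rspan f v : v != 0 -> ker_points f (rspan v) <-> f *m v = 0.
Proof.
move=> v0; split=> [[w [w0 fw /(rspan_eqP _ _ v0)[a a0 ->]]]|fv]; last by exists v.
by rewrite mulmxA fw mul0mx.
Qed.

Lemma hyperplane_ker_points H : hyperplane H -> exists f, H = ker_points f.
Proof.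
case=> r [C [/addIr[] dr freeC ->]]; case: _ / dr C freeC => C freeC.
have [f spanC] := rfree_hyperplane_form _ freeC.
exists f; apply/seteqP; split=> p.
  by case=> /proj_spaceP[v v0 ->] /rspan_col_sub/spanC fv; exists v.
case=> v [v0 fv ->]; split; first exact: proj_space_rspan.
exact/rspan_col_sub/spanC.
Qed.

Lemma line_rfree (u v : 'cV[D]_d.+1) : rfree (row_mx u v) ->
  line [set p | proj_space p /\ p `<=` rspan (row_mx u v)].
Proof. by move=> fuv; exists 2, (row_mx u v). Qed.

(** With respect to two vectors generating the line, [u1] and [u2] have a free, hence invertible, 2
    by 2 coordinate matrix; its inverse gives the coefficients of [u3]. *)
Lemma line_third l (u1 u2 u3 : 'cV[D]_d.+1) : line l ->
  l (rspan u1) -> l (rspan u2) -> l (rspan u3) -> rfree (row_mx u1 u2) ->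
  exists a c : D, u3 = u1 *m a%:M + u2 *m c%:M.
Proof.
case=> r [C [r2 freeC ->]]; have dr : 2 = r.
  by move: r2; rewrite -[1 in LHS]/(2%:Z - 1) => /addIr[].
case: _ / dr C freeC {r2} => C freeC.
move=> [_ /rspan_col_sub[x1 _ <-]] [_ /rspan_col_sub[x2 _ <-]].
move=> [_ /rspan_col_sub[x3 _ <-]].
rewrite -mul_mx_row => free12.
have free_x : rfree (row_mx x1 x2 : 'M_2).
  by move=> y xy; apply: free12; rewrite -mulmxA xy mulmx0.
have [Y [XY _]] := rfree_square _ free_x.
exists (usubmx (Y *m x3 : 'cV_(1 + 1)) 0 0), (dsubmx (Y *m x3 : 'cV_(1 + 1)) 0 0).
have XYx : (row_mx x1 x2 : 'M_2) *m (Y *m x3) = x3 by rewrite mulmxA XY mul1mx.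
rewrite -!cV1_scalar -!mulmxA -mulmxDr -(mul_row_col x1 x2) vsubmxK.
by congr (_ *m _).
Qed.

End Projective.

(** * Computing with homogeneous coordinates in block form *)

Section Coordinates.
Context {D : skewFieldType} {m : nat}.

Local Notation coords := (@hcoord D m.+2).

(** Block form turns the list encoding into something the block-matrix lemmas can compute with. *)
Lemma hcoordE (a b c : D) (x : 'cV[D]_m) :
  coords a b c x =
  (col_mx a%:M (col_mx b%:M (col_mx c%:M x)) : 'cV_(1 + (1 + (1 + m)))).
Proof.
apply/colP => i; rewrite mxE [RHS]mxE.
case: splitP => [j ->|j ->]; first by rewrite ord1 mxE.
rewrite add1n /= [RHS]mxE.
case: splitP => [k ->|k ->]; first by rewrite ord1 mxE.
rewrite add1n /= [RHS]mxE.
case: splitP => [l ->|l ->]; first by rewrite ord1 mxE.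
by rewrite add1n /= (nth_map l) ?size_enum_ord // nth_ord_enum.
Qed.

Definition frame_mx {k} (e1 e2 e3 : 'cV[D]_k) (C : 'M[D]_(k, m)) :
    'M[D]_(k, m.+3) :=
  row_mx e1 (row_mx e2 (row_mx e3 C) : 'M_(k, 1 + (1 + m))).

Lemma frame_mx_hcoord {k} (e1 e2 e3 : 'cV[D]_k) C a b c x :
  frame_mx e1 e2 e3 C *m coords a b c x =
  e1 *m a%:M + e2 *m b%:M + e3 *m c%:M + C *m x.
Proof.
rewrite hcoordE /frame_mx (mul_row_col e1) (mul_row_col e2) (mul_row_col e3).
by rewrite !addrA.
Qed.

Lemma hcoord_inj (a b c a' b' c' : D) (x x' : 'cV[D]_m) :
  coords a b c x = coords a' b' c' x' ->
  [/\ a = a', b = b', c = c' & x = x'].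
Proof.
have scalar_inj (s t : D) : s%:M = t%:M :> 'M_1 -> s = t.
  by move=> /matrixP/(_ 0 0); rewrite !mxE eqxx !mulr1n.
rewrite !hcoordE => /(@eq_col_mx _ 1 (1 + (1 + m)) 1)[/scalar_inj->].
by move=> /eq_col_mx[/scalar_inj-> /eq_col_mx[/scalar_inj->]].
Qed.

Lemma hcoord_scale (a b c s : D) (x : 'cV[D]_m) :
  coords a b c x *m s%:M =
  coords (a * s) (b * s) (c * s) (x *m s%:M).
Proof.
by rewrite !hcoordE (@mul_col_mx _ 1 (1 + (1 + m))) !mul_col_mx -!scalar_mxM.
Qed.

Lemma hcoordD (a b c a' b' c' : D) (x x' : 'cV[D]_m) :
  coords a b c x + coords a' b' c' x' =
  coords (a + a') (b + b') (c + c') (x + x').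
Proof.
by rewrite !hcoordE (@add_col_mx _ 1 (1 + (1 + m))) !add_col_mx -!raddfD.
Qed.

Lemma hcoord0 : coords 0 0 0 0 = 0.
Proof. by rewrite hcoordE !raddf0 !col_mx0. Qed.

Lemma hcoord_coords (a b c : D) (x : 'cV[D]_m) :
  [/\ coords a b c x (inord 0) 0 = a,
      coords a b c x (inord 1) 0 = b &
      coords a b c x (inord 2) 0 = c].
Proof. by split; rewrite mxE inordK. Qed.

Lemma hcoord_surj (v : 'cV[D]_m.+3) :
  exists x, v = coords (v (inord 0) 0) (v (inord 1) 0) (v (inord 2) 0) x.
Proof.
suff [a [b [c [x ->]]]] : exists a b c x, v = coords a b c x.
  by have [-> -> ->] := hcoord_coords a b c x; exists x.
move: v; rewrite -[m.+3]/(1 + (1 + (1 + m)))%N => v.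
exists (usubmx v 0 0), (usubmx (dsubmx v) 0 0).
exists (usubmx (dsubmx (dsubmx v)) 0 0), (dsubmx (dsubmx (dsubmx v))).
by rewrite hcoordE -!cV1_scalar !vsubmxK.
Qed.

Lemma semidirect_eq (g h : semidirect D m) : g.1 = h.1 -> g.2 = h.2 -> g = h.
Proof.
by case: g h => [[a x] ha] [[b y] hb] /= ab xy; apply: val_inj; rewrite /= ab xy.
Qed.

Lemma rfree_row2 {k} (u v : 'cV[D]_k) :
  (forall a c : D, u *m a%:M + v *m c%:M = 0 -> a = 0 /\ c = 0) ->
  rfree (row_mx u v).
Proof.
move=> uv x; rewrite -[x](@vsubmxK _ 1 1) mul_row_col.
rewrite (cV1_scalar (usubmx _)) (cV1_scalar (dsubmx _)) => /uv[-> ->].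
by rewrite !raddf0 col_mx0.
Qed.

(** * Labelled points in a fixed basis and the collinearity criterion *)

Section Basis.
Variable b : 'M[D]_m.+3.
Hypothesis basis_b : rbasis b.

Lemma rbasis_mul_inj k : injective (fun x : 'M[D]_(m.+3, k) => b *m x).
Proof.
have [B [_ Bb]] := rfree_square _ (proj1 basis_b).
by move=> x y /(congr1 (mulmx B)); rewrite !mulmxA Bb !mul1mx.
Qed.

Lemma rbasis_mul_eq0 (x : 'cV[D]_m.+3) : (b *m x == 0) = (x == 0).
Proof. by rewrite -(inj_eq (@rbasis_mul_inj 1)) mulmx0. Qed.

Lemma hpoint_eqP (x y : 'cV[D]_m.+3) : x != 0 ->
  @hpoint D m.+2 b x = hpoint b y <-> exists2 s : D, s != 0 & x = y *m s%:M.
Proof.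
move=> x0; rewrite /hpoint; split.
  case/(rspan_eqP _ _); rewrite ?rbasis_mul_eq0 // => s s0.
  by rewrite -mulmxA => /rbasis_mul_inj->; exists s.
by case=> s s0 ->; rewrite mulmxA rspan_scale.
Qed.

Lemma proj_space_hpoint (x : 'cV[D]_m.+3) : x != 0 ->
  proj_space (@hpoint D m.+2 b x).
Proof. by move=> x0; apply: proj_space_rspan; rewrite rbasis_mul_eq0. Qed.

Lemma coord_hyperplane_hpoint i (x : 'cV[D]_m.+3) : x != 0 ->
  @coord_hyperplane D m.+2 b i (hpoint b x) <-> x (inord i) 0 = 0.
Proof.
move=> x0; split=> [[y [y0 yi /(hpoint_eqP _ _ x0)[s s0 ->]]]|xi]; last by exists x.
by rewrite mulmx_scalarE yi mul0r.
Qed.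

(** The generators are the columns of [b] with the one of index [inord i] removed. *)
Lemma coord_hyperplane_hyperplane i : hyperplane (@coord_hyperplane D m.+2 b i).
Proof.
exists m.+2, (b *m insert_mx (inord i)); split=> //.
  move=> x; rewrite -mulmxA => /eqP; rewrite rbasis_mul_eq0 => /eqP Ix.
  by rewrite -[x]mul1mx -(tr_insert_mxK (inord i)) -mulmxA Ix mulmx0.
have spanP x : rspan (b *m insert_mx (inord i)) (b *m x) <-> x (inord i) 0 = 0.
  rewrite -insert_mx_coordP; split=> [[y _]|[y _ <-]].
    by rewrite -mulmxA => /rbasis_mul_inj <-; exists y.
  by exists y; rewrite // mulmxA.
apply/seteqP; split=> p.
  case=> x [x0 xi ->]; split; first exact: proj_space_hpoint.
  by apply/rspan_col_sub/spanP.
case=> /proj_spaceP[v v0 ->] /rspan_col_sub.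
have [B [bB _]] := rfree_square _ (proj1 basis_b).
rewrite -[v]mul1mx -bB -mulmxA => /spanP Bvi; exists (B *m v); split=> //.
by apply: contraNneq v0 => Bv; rewrite -[v]mul1mx -bB -mulmxA Bv mulmx0.
Qed.

Definition point1 (g : semidirect D m) := @hpoint D m.+2 b (coords 0 g.1 1 g.2).
Definition point2 (g : semidirect D m) := @hpoint D m.+2 b (coords g.1 0 1 g.2).
Definition point3 (g : semidirect D m) := @hpoint D m.+2 b (coords (- 1) g.1 0 g.2).

Lemma hcoord_neq0 (a a' c : D) (x : 'cV[D]_m) :
  [|| a != 0, a' != 0 | c != 0] -> coords a a' c x != 0.
Proof.
apply: contraTneq; rewrite -hcoord0 => /hcoord_inj[-> -> -> _].
by rewrite eqxx.
Qed.

(** Each kind of point has one coordinate fixed to 1 or -1, which forces the proportionality factor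
    to be 1. *)
Lemma points_inj :
  [/\ injective point1, injective point2 & injective point3].
Proof.
split=> g h.
- case/hpoint_eqP; first by rewrite hcoord_neq0 // oner_eq0 !orbT.
  move=> s s0; rewrite hcoord_scale mul1r => /hcoord_inj[_ g1 s1 g2].
  by apply: semidirect_eq; rewrite ?g1 ?g2 -s1 ?mulr1 ?mulmx1.
- case/hpoint_eqP; first by rewrite hcoord_neq0 // oner_eq0 !orbT.
  move=> s s0; rewrite hcoord_scale mul1r => /hcoord_inj[g1 _ s1 g2].
  by apply: semidirect_eq; rewrite ?g1 ?g2 -s1 ?mulr1 ?mulmx1.
case/hpoint_eqP; first by rewrite hcoord_neq0 // oppr_eq0 oner_eq0.
move=> s s0; rewrite hcoord_scale mulN1r => /hcoord_inj[/oppr_inj s1 g1 _ g2].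
by apply: semidirect_eq; rewrite ?g1 ?g2 -s1 ?mulr1 ?mulmx1.
Qed.

(** A label has nonzero first component, and this keeps the point off the second hyperplane. *)
Lemma point1_hyperplanes g :
  [/\ proj_space (point1 g), coord_hyperplane b 0 (point1 g),
      ~ coord_hyperplane b 1 (point1 g) & ~ coord_hyperplane b 2 (point1 g)].
Proof.
have x0 : coords 0 g.1 1 g.2 != 0 by rewrite hcoord_neq0 // oner_eq0 !orbT.
have [c0 c1 c2] := hcoord_coords 0 g.1 1 g.2; have := sd_valP g => /eqP g0.
split; first exact: proj_space_hpoint.
- exact/coord_hyperplane_hpoint.
- by rewrite coord_hyperplane_hpoint // c1.
- by rewrite coord_hyperplane_hpoint // c2; apply/eqP; rewrite oner_eq0.
Qed.

Lemma point2_hyperplanes g :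
  [/\ proj_space (point2 g), coord_hyperplane b 1 (point2 g),
      ~ coord_hyperplane b 0 (point2 g) & ~ coord_hyperplane b 2 (point2 g)].
Proof.
have x0 : coords g.1 0 1 g.2 != 0 by rewrite hcoord_neq0 // oner_eq0 !orbT.
have [c0 c1 c2] := hcoord_coords g.1 0 1 g.2; have := sd_valP g => /eqP g0.
split; first exact: proj_space_hpoint.
- exact/coord_hyperplane_hpoint.
- by rewrite coord_hyperplane_hpoint // c0.
- by rewrite coord_hyperplane_hpoint // c2; apply/eqP; rewrite oner_eq0.
Qed.

Lemma point3_hyperplanes g :
  [/\ proj_space (point3 g), coord_hyperplane b 2 (point3 g),
      ~ coord_hyperplane b 0 (point3 g) & ~ coord_hyperplane b 1 (point3 g)].
Proof.
have x0 : coords (- 1) g.1 0 g.2 != 0.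
  by rewrite hcoord_neq0 // oppr_eq0 oner_eq0.
have [c0 c1 c2] := hcoord_coords (- 1) g.1 0 g.2; have := sd_valP g => /eqP g0.
split; first exact: proj_space_hpoint.
- exact/coord_hyperplane_hpoint.
- by rewrite coord_hyperplane_hpoint // c0; apply/eqP; rewrite oppr_eq0 oner_eq0.
- by rewrite coord_hyperplane_hpoint // c1.
Qed.

Lemma rfree_point12 (g1 g2 : semidirect D m) :
  rfree (row_mx (b *m coords 0 g1.1 1 g1.2)
                (b *m coords g2.1 0 1 g2.2)).
Proof.
apply: rfree_row2 => a c; rewrite -!mulmxA -mulmxDr => /eqP.
rewrite rbasis_mul_eq0 !hcoord_scale hcoordD -hcoord0 => /eqP/hcoord_inj[].
rewrite !mul0r add0r addr0 => /eqP + /eqP + _ _.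
by rewrite !skew_mul_eq0 (negPf (sd_valP g1)) (negPf (sd_valP g2)) => /eqP-> /eqP->.
Qed.

(** The four coordinate blocks of u3 = u1 a + u2 c are compared: they give c = -a, then a as the
    inverse of [g2.1], and finally both components of [g3] as those of g1 g2^-1. *)
Lemma line_points l g1 g2 g3 : line l ->
  l (point1 g1) -> l (point2 g2) -> l (point3 g3) -> g1 = (g3 * g2)%g.
Proof.
move=> line_l l1 l2 l3.
have [a [c]] := line_third _ _ _ _ line_l l1 l2 l3 (rfree_point12 g1 g2).
rewrite -!mulmxA -mulmxDr => /rbasis_mul_inj.
rewrite !hcoord_scale hcoordD => /hcoord_inj[].
rewrite !mul1r !mul0r add0r addr0 => g2c g3a ac g3x.
have ca : c = - a by apply/eqP; rewrite -addr_eq0 addrC -ac.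
(* Comparing first coordinates makes [a] a right inverse of [g2.1]; the rest of the computation
   needs it on the left. *)
have ag2 : a * g2.1 = 1.
  have a_inv : g2.1 * a = 1 by apply: oppr_inj; rewrite g2c ca mulrN.
  have -> : a = g2.1^-1.
    by rewrite -[RHS]mulr1 -a_inv mulrA skew_mulVr ?mul1r ?(sd_valP g2).
  exact: skew_mulVr (sd_valP g2).
apply: semidirect_eq => /=; first by rewrite g3a -mulrA ag2 mulr1.
rewrite g3x ca mulmxDl -!mulmxA -!scalar_mxM mulNr ag2 mulmx1 raddfN /=.
by rewrite mulmxN mulmx1 subrK.
Qed.

Lemma points_line g1 g2 g3 : g1 = (g3 * g2)%g ->
  exists l, [/\ line l, l (point1 g1), l (point2 g2) & l (point3 g3)].
Proof.
move=> g123.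
have free12 := rfree_point12 g1 g2; eexists; split; first exact: line_rfree free12.
- split; first by case: (point1_hyperplanes g1).
  apply/rspan_col_sub; exists (col_mx 1%:M 0 : 'cV_(1 + 1)) => //.
  by rewrite mul_row_col mulmx1 mulmx0 addr0.
- split; first by case: (point2_hyperplanes g2).
  apply/rspan_col_sub; exists (col_mx 0 1%:M : 'cV_(1 + 1)) => //.
  by rewrite mul_row_col mulmx1 mulmx0 add0r.
split; first by case: (point3_hyperplanes g3).
apply/rspan_col_sub.
(* These are the coefficients a and -a forced in [line_points]. *)
exists (col_mx (g2.1^-1)%:M (- g2.1^-1)%:M : 'cV_(1 + 1)) => //.
rewrite mul_row_col -!mulmxA -mulmxDr; congr (_ *m _).
rewrite !hcoord_scale hcoordD g123 /= !mul0r !mul1r add0r addr0 mulrN.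
rewrite skew_mulrV ?(sd_valP g2) // subrr mulmxDl -!mulmxA -!scalar_mxM.
rewrite -mulrA skew_mulrV ?(sd_valP g2) // mulr1 mulmx1.
by rewrite raddfN /= mulmxN addrK.
Qed.

Lemma collinear_points g1 g2 g3 :
  collinear [set point1 g1; point2 g2; point3 g3] <-> g1 = (g3 * g2)%g.
Proof.
split=> [[l line_l subl]|/points_line[l [line_l l1 l2 l3]]].
  apply: (line_points _ _ _ _ line_l); apply: subl.
  - by left; left.
  - by left; right.
  - by right.
by exists l => // p [[]|] ->.
Qed.

End Basis.

End Coordinates.

(** * Existence of adapted coordinates *)

Section AdaptedFrame.
Context {D : skewFieldType} {m : nat}.

Local Notation coords := (@hcoord D m.+2).

Lemma cV1_div (c x : 'cV[D]_1) : c != 0 -> exists a : D, x = c *m a%:M.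
Proof.
rewrite (cV1_scalar c) scalar_mx11_eq0 => c0; exists ((c 0 0)^-1 * x 0 0).
by rewrite scalar_mxM mulmxA -scalar_mxM skew_mulrV // mul1mx -cV1_scalar.
Qed.

(** The first three basis vectors are to be dual, up to scalars, to the three forms, and [C]
    supplies the others. Since [u1] and [u2] must become e2 + e3 and e1 + e3, only e3 is left to
    find; the assumption that [f3] agrees on [u1] and [u2] lets one e3 serve both. *)
Lemma adapted_frame (f1 f2 f3 : 'rV[D]_m.+3) (C : 'M[D]_(m.+3, m))
    (u1 u2 : 'cV[D]_m.+3) :
  rfree C ->
  (forall x : 'cV[D]_m.+3,
     rspan C x <-> [/\ f1 *m x = 0, f2 *m x = 0 & f3 *m x = 0]) ->
  f1 *m u1 = 0 -> f2 *m u1 != 0 -> f1 *m u2 != 0 -> f2 *m u2 = 0 ->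
  f3 *m u1 = f3 *m u2 -> f3 *m u1 != 0 ->
  exists b : 'M[D]_m.+3,
    [/\ rbasis b, b *m coords 0 1 1 0 = u1, b *m coords 1 0 1 0 = u2 &
    forall x : 'cV[D]_m.+3,
      [/\ f1 *m (b *m x) = 0 <-> x (inord 0) 0 = 0,
          f2 *m (b *m x) = 0 <-> x (inord 1) 0 = 0 &
          f3 *m (b *m x) = 0 <-> x (inord 2) 0 = 0]].
Proof.
move=> freeC spanC f1u1 f2u1 f1u2 f2u2 f3u12 f3u1.
have [w [f1w f2w f3w]] : exists w : 'cV[D]_m.+3,
    [/\ f1 *m w = 0, f2 *m w = 0 & f3 *m w != 0].
  (* Without such a vector, subtracting multiples of [u1] and [u2] would bring every vector into the
     span of [C], so m + 2 vectors would span a space of dimension m + 3. *)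
  apply: contrapT => no_w.
  suff /rspan_leq : forall v : 'cV[D]_m.+3, rspan (row_mx u1 (row_mx u2 C)) v.
    by rewrite !add1n ltnn.
  move=> v; have [a va] := cV1_div _ (f1 *m v) f1u2.
  have [c vc] := cV1_div _ (f2 *m v) f2u1.
  have /spanC[x _ Cx] : [/\ f1 *m (v - u1 *m c%:M - u2 *m a%:M) = 0,
      f2 *m (v - u1 *m c%:M - u2 *m a%:M) = 0 &
      f3 *m (v - u1 *m c%:M - u2 *m a%:M) = 0].
    have g1 : f1 *m (v - u1 *m c%:M - u2 *m a%:M) = 0.
      by rewrite !mulmxBr !mulmxA f1u1 mul0mx subr0 va subrr.
    have g2 : f2 *m (v - u1 *m c%:M - u2 *m a%:M) = 0.
      by rewrite !mulmxBr !mulmxA f2u2 mul0mx subr0 vc subrr.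
    split=> //; apply: contrapT => /eqP g3; apply: no_w.
    by exists (v - u1 *m c%:M - u2 *m a%:M).
  exists (col_mx c%:M (col_mx a%:M x)) => //.
  by rewrite !mul_row_col Cx [u2 *m _ + _]addrC subrK addrC subrK.
have [a f3wa] := cV1_div _ (f3 *m u1) f3w.
pose e3 := w *m a%:M; pose e2 := u1 - e3; pose e1 := u2 - e3.
have f1e3 : f1 *m e3 = 0 by rewrite mulmxA f1w mul0mx.
have f2e3 : f2 *m e3 = 0 by rewrite mulmxA f2w mul0mx.
have f3e3 : f3 *m e3 = f3 *m u1 by rewrite mulmxA -f3wa.
have f1e2 : f1 *m e2 = 0 by rewrite mulmxBr f1u1 f1e3 subr0.
have f2e2 : f2 *m e2 = f2 *m u1 by rewrite mulmxBr f2e3 subr0.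
have f3e2 : f3 *m e2 = 0 by rewrite mulmxBr f3e3 subrr.
have f1e1 : f1 *m e1 = f1 *m u2 by rewrite mulmxBr f1e3 subr0.
have f2e1 : f2 *m e1 = 0 by rewrite mulmxBr f2u2 f2e3 subr0.
have f3e1 : f3 *m e1 = 0 by rewrite mulmxBr f3e3 f3u12 subrr.
have u1E : e2 + e3 = u1 by rewrite subrK.
have u2E : e1 + e3 = u2 by rewrite subrK.
(* From here on only the values of the forms and the two sums matter. *)
clearbody e1 e2; clearbody e3.
have C_ker (x : 'cV[D]_m) :
    [/\ f1 *m (C *m x) = 0, f2 *m (C *m x) = 0 & f3 *m (C *m x) = 0].
  by apply/spanC; exists x.
pose b := frame_mx e1 e2 e3 C.
have forms (x : 'cV[D]_m.+3) : [/\ f1 *m (b *m x) = 0 <-> x (inord 0) 0 = 0,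
          f2 *m (b *m x) = 0 <-> x (inord 1) 0 = 0 &
          f3 *m (b *m x) = 0 <-> x (inord 2) 0 = 0].
  have [y ->] := hcoord_surj x.
  move: (x (inord 0) 0) (x (inord 1) 0) (x (inord 2) 0) => s1 s2 s3.
  have [-> -> ->] := hcoord_coords s1 s2 s3 y; have [k1 k2 k3] := C_ker y.
  have cancel_form (c : 'cV[D]_1) s : c != 0 -> c *m s%:M = 0 <-> s = 0.
    move=> c0; split=> [/eqP|->]; last by rewrite raddf0 mulmx0.
    by rewrite mulmx_scalar_eq0 (negPf c0) => /eqP.
  rewrite /b frame_mx_hcoord !mulmxDr k1 k2 k3 !addr0 !mulmxA.
  rewrite f1e1 f1e2 f1e3 f2e1 f2e2 f2e3 f3e1 f3e2 f3e3 !mul0mx !addr0 !add0r.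
  by split; exact: cancel_form.
(* The forms kill the first three coefficients of a dependence, and freeness of [C] the others. *)
have free_b : rfree b.
  move=> x bx; have := forms x; rewrite bx !mulmx0 => -[] /proj1/(_ erefl) x1.
  move=> /proj1/(_ erefl) x2 /proj1/(_ erefl) x3.
  have [y xE] := hcoord_surj x; move: bx; rewrite xE x1 x2 x3.
  rewrite /b frame_mx_hcoord !raddf0 !add0r => /freeC->.
  exact: hcoord0.
exists b; split=> //.
- exact/GL_rbasis/rfree_square.
- by rewrite /b frame_mx_hcoord !raddf0 !mulmx1 add0r addr0.
- by rewrite /b frame_mx_hcoord !raddf0 !mulmx1 !addr0.
Qed.

(** Representatives of [p1] and [p2] are still free up to scalars. The relation u3 = u1 a + u2 c
    selects u1 a and -u2 c: their difference represents [p3], and [f3] takes the same value on both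
    since it vanishes on u3. *)
Lemma adapted_coordinates_exist (H1 H2 H3 : set (set 'cV[D]_m.+3)) p1 p2 p3 l :
  hyperplane H1 -> hyperplane H2 -> hyperplane H3 ->
  @flat D m.+2 (m.+2%:Z - 3) (H1 `&` H2 `&` H3) ->
  H1 p1 -> ~ H2 p1 -> ~ H3 p1 -> H2 p2 -> ~ H1 p2 -> ~ H3 p2 -> H3 p3 ->
  line l -> l p1 -> l p2 -> l p3 ->
  exists b, adapted_coordinates H1 H2 H3 p1 p2 p3 b.
Proof.
move=> /hyperplane_ker_points[f1 ->] /hyperplane_ker_points[f2 ->].
move=> /hyperplane_ker_points[f3 ->] [r [C [mr freeC capE]]].
(* A flat of dimension k has k + 1 generators, so dimension d - 3 with d = m + 2 means [m]
   generators. *)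
have {}mr : m = r.
  by move: mr; rewrite -addn2 PoszD -[3]/(2%:Z + 1) opprD addrA addrK => /addIr[].
case: _ / mr C freeC capE => C freeC capE.
case=> u1 [u10 f1u1 ->]; rewrite !ker_points_rspan // => /eqP f2u1 /eqP f3u1.
case=> u2 [u20 f2u2 ->]; rewrite !ker_points_rspan // => /eqP f1u2 /eqP f3u2.
case=> u3 [u30 f3u3 ->] line_l l1 l2 l3.
have spanC x : rspan C x <-> [/\ f1 *m x = 0, f2 *m x = 0 & f3 *m x = 0].
  (* The zero vector is not a point, so the equality of flats says nothing about it. *)
  have [->|x0] := eqVneq x 0.
    by rewrite !mulmx0; split=> // _; exists 0; rewrite ?mulmx0.
  have := congr1 (fun F => F (rspan x)) capE.
  move=> /= capEx; split=> [Cx|[f1x f2x f3x]].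
    have : proj_space (rspan x) /\ rspan x `<=` rspan C.
      by split; [exact: proj_space_rspan | apply/rspan_col_sub].
    by rewrite -capEx => -[[]]; rewrite !ker_points_rspan.
  suff : proj_space (rspan x) /\ rspan x `<=` rspan C by case=> _ /rspan_col_sub.
  by rewrite -capEx; split; [split|]; exact/ker_points_rspan.
have free12 : rfree (row_mx u1 u2).
  apply: rfree_row2 => a c /[dup] /(congr1 (mulmx f1)) + /(congr1 (mulmx f2)).
  rewrite !mulmxDr !mulmxA f1u1 f2u2 !mulmx0 !mul0mx add0r addr0 => /eqP + /eqP.
  by rewrite !mulmx_scalar_eq0 (negPf f1u2) (negPf f2u1) => /eqP-> /eqP->.
have [a [c u3E]] := line_third _ _ _ _ line_l l1 l2 l3 free12.
have f3ac : f3 *m u1 *m a%:M = f3 *m u2 *m (- c)%:M.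
  apply/eqP; rewrite raddfN mulmxN -addr_eq0 -!mulmxA -mulmxDr -u3E.
  exact/eqP.
(* By [f3ac], if one coefficient vanishes then so does the other, and u3 would be zero. *)
have [a0 c0] : a != 0 /\ c != 0.
  split; apply: contra_neqN u30 => /eqP z0; rewrite u3E; move: f3ac.
    move=> /esym/eqP; rewrite z0 !raddf0 ?mulmx0 mulmx_scalar_eq0 (negPf f3u2).
    by rewrite oppr_eq0 => /eqP->; rewrite raddf0 ?mulmx0 addr0.
  move=> /eqP; rewrite z0 oppr0 !raddf0 ?mulmx0 mulmx_scalar_eq0 (negPf f3u1).
  by move=> /eqP->; rewrite raddf0 ?mulmx0 addr0.
have [||||||b [basis_b bu1 bu2 forms]] :=
  adapted_frame f1 f2 f3 C (u1 *m a%:M) (u2 *m (- c)%:M) freeC spanC.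
- by rewrite mulmxA f1u1 mul0mx.
- by rewrite mulmxA mulmx_scalar_eq0 negb_or f2u1.
- by rewrite mulmxA mulmx_scalar_eq0 negb_or f1u2 oppr_eq0.
- by rewrite mulmxA f2u2 mul0mx.
- by rewrite !mulmxA.
- by rewrite mulmxA mulmx_scalar_eq0 negb_or f3u1.
have [B [bB _]] := rfree_square _ (proj1 basis_b).
have hyperplaneE (f : 'rV[D]_m.+3) i :
    (forall x : 'cV[D]_m.+3, f *m (b *m x) = 0 <-> x (inord i) 0 = 0) ->
    ker_points f = coord_hyperplane b i.
  move=> fP; apply/seteqP; split=> p.
    case=> v [v0 fv ->]; have vE : v = b *m (B *m v) by rewrite mulmxA bB mul1mx.
    exists (B *m v); split; last by rewrite /hpoint -vE.
      by apply: contraNneq v0 => Bv; rewrite vE Bv mulmx0.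
    by apply: (proj1 (fP _)); rewrite -vE.
  case=> x [x0 xi ->]; exists (b *m x); split=> //; last exact: (proj2 (fP _)).
  by rewrite rbasis_mul_eq0.
exists b; split=> //; last first.
  by split; apply: hyperplaneE => x; case: (forms x).
split; rewrite /hpoint ?bu1 ?bu2 ?rspan_scale ?oppr_eq0 //.
have -> : coords (- 1) 1 0 0 = coords 0 1 1 0 - coords 1 0 1 0.
  rewrite -[- coords _ _ _ _]mulmx1 mulNmx -mulmxN -raddfN hcoord_scale hcoordD.
  by rewrite !mulrN1 !oppr0 !addr0 add0r subrr mul0mx addr0.
by rewrite mulmxBr bu1 bu2 raddfN mulmxN opprK -u3E.
Qed.

End AdaptedFrame.

(** * Transversal designs *)

Section TransversalDesigns.
Context {T : Type}.
Implicit Types (V B X Y Z : set T) (P Bl : set (set T)).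

Lemma sub_pair_card {U : Type} (S : set U) (a b : U) :
  S `<=` [set a; b] -> ~ (S #= `I_3)%card.
Proof.
move=> Sab /card_eqPle[_ S3]; have : (`I_3 #<= `I_2)%card; last first.
  by rewrite card_le_II.
apply: (card_le_trans S3); apply: (card_le_trans (subset_card_le Sab)).
rewrite (_ : [set a; b] = (fun i => if i == 0%N then a else b) @` `I_2).
  exact: card_image_le.
apply/seteqP; split=> [u [->|->]|u [[|i] _ <-]] /=.
- by exists 0%N.
- by exists 1%N.
- by left.
- by right.
Qed.

Lemma set3_rot {U : Type} (a b c : U) : [set a; b; c] = [set b; c; a].
Proof. by rewrite -setUA setUC. Qed.

Lemma set3_swap {U : Type} (a b c : U) : [set a; b; c] = [set b; a; c].
Proof. by rewrite (setUC [set a]). Qed.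

Lemma td_part_block n V P Bl X B x y :
  transversal_design 3 n V P Bl -> P X -> Bl B ->
  X x -> X y -> B x -> B y -> x = y.
Proof.
case=> _ _ _ BlV td PX BlB Xx Xy Bx By; apply: contrapT => xy.
have [BV _] := BlV _ BlB.
case: (td x y (BV x Bx) (BV y By) xy) => -[_].
  by case; exists B.
by case; exists X.
Qed.

(** Two parts with a common point are equal, and then the list of three would contain at most two
    distinct parts. *)
Lemma td_disjoint n V Bl X Y Z x : 
  transversal_design 3 n V [set X; Y; Z] Bl -> X x -> ~ Y x.
Proof.
case=> _ _ [[_ trivP _] cardP _] _ _ Xx Yx.
have XY : X = Y.
  apply: trivP; [by left; left | by left; right | by exists x].
apply: sub_pair_card cardP => W [[]|] ->; rewrite ?XY; [by left.. | by right].
Qed.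

(** Points of different parts are joined by a block, not by a part. The remaining point of the block
    shares a part with neither of them, so it lies in [Z]; the block is unique and meets [Z] only
    once. *)
Lemma td_third n V Bl X Y Z x y :
  transversal_design 3 n V [set X; Y; Z] Bl -> X x -> Y y ->
  exists z, [/\ Z z, exists2 B, Bl B & [/\ B x, B y & B z] &
    forall z' B, Z z' -> Bl B -> B x -> B y -> B z' -> z' = z].
Proof.
move=> td Xx Yy; case: (td) => _ _ [[coverP _ _] _ _] BlV td2.
have xy : x <> y by move=> xy; apply: (td_disjoint _ _ _ _ _ _ _ td Xx); rewrite xy.
have PX : [set X; Y; Z] X by left; left.
have PY : [set X; Y; Z] Y by left; right.
have PZ : [set X; Y; Z] Z by right.
have inV W w : [set X; Y; Z] W -> W w -> V w by rewrite -coverP; exists W.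
case: (td2 x y (inV _ _ PX Xx) (inV _ _ PY Yy) xy) => -[[B [[BB Bx By] B_uniq]] _].
  have YX : transversal_design 3 n V [set Y; X; Z] Bl by rewrite set3_swap.
  move: Bx By; case: BB => [[]|] -> Bx By.
  - by case: (td_disjoint _ _ _ _ _ _ _ YX Yy).
  - by case: (td_disjoint _ _ _ _ _ _ _ td Xx).
  have XZ : transversal_design 3 n V [set Z; X; Y] Bl by rewrite set3_rot.
  by case: (td_disjoint _ _ _ _ _ _ _ XZ Bx).
have [BV cardB] := BlV _ BB.
have [z [Bz zx zy]] : exists z, [/\ B z, z <> x & z <> y].
  apply: contrapT => no_z; apply: sub_pair_card cardB => z Bz.
  apply: contrapT => /not_orP[zx zy]; apply: no_z; exists z.
  by split; [exact: Bz|exact: zx|exact: zy].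
have : V z by exact: BV.
rewrite -coverP => -[W [[]|] -> Wz].
- by case: zx; exact: (td_part_block _ _ _ _ _ _ _ _ td PX BB Wz Xx Bz Bx).
- by case: zy; exact: (td_part_block _ _ _ _ _ _ _ _ td PY BB Wz Yy Bz By).
exists z; split=> //; first by exists B.
move=> z' B' Zz' BB' B'x B'y B'z'; move: B'z'; rewrite -(B_uniq B') // => Bz'.
exact: (td_part_block _ _ _ _ _ _ _ _ td PZ BB Zz' Wz Bz' Bz).
Qed.

End TransversalDesigns.

(** * The group of an embedded design *)

Lemma set3_card {T : Type} (a b c : T) : a <> b -> a <> c -> b <> c ->
  ([set a; b; c] #= `I_3)%card.
Proof.
move=> ab ac bc.
pose f i := if i == 0%N then a else if i == 1%N then b else c.
have -> : [set a; b; c] = f @` `I_3.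
  apply/seteqP; split=> [u [[->|->]|->]|u [[|[|[|//]]] _ <-]].
  - by exists 0%N.
  - by exists 1%N.
  - by exists 2.
  - by left; left.
  - by left; right.
  - by right.
apply: inj_card_eq => i j; rewrite !in_setE /=.
by case: i => [|[|[|//]]]; case: j => [|[|[|//]]] // _ _ /=; rewrite /f /=;
  move=> // /esym.
Qed.

(** Pairs are numbered as i n + f(x), and division with remainder by n recovers i and f(x). *)
Lemma setX_I_card {T : Type} (A : set T) (k n : nat) : (A #= `I_n)%card ->
  (`I_k `*` A #= `I_(k * n))%card.
Proof.
move=> /card_set_bijP[f [fn finj fsurj]].
apply/card_set_bijP; exists (fun u => u.1 * n + f u.2)%N; split.
- move=> [i x] [/= ik Ax]; have /= fx := fn x Ax.
  by rewrite (@leq_trans (i.+1 * n)) // ?leq_mul2r ?ik ?orbT // mulSn addnC ltn_add2r.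
- move=> [i x] [j y]; rewrite !in_setE => -[/= ik Ax] [/= jk Ay] ij.
  have /= fx := fn x Ax; have /= fy := fn y Ay.
  have n0 : (0 < n)%N by case: n fx {fn fsurj fy ij}.
  have := congr1 (modn^~ n) ij; rewrite /= !modnMDl !modn_small // => fxy.
  have := congr1 (divn^~ n) ij; rewrite /= !divnMDl // !divn_small // !addn0 => ->.
  by rewrite (finj x y) // in_setE.
move=> i /= ikn; have n0 : (0 < n)%N by case: n ikn {fn fsurj}; rewrite ?muln0.
have [x Ax fx] := fsurj (i %% n)%N (ltn_pmod i n0).
exists ((i %/ n)%N, x); first by split; rewrite //= ltn_divLR.
by rewrite /= fx -divn_eq.
Qed.

(** * The three families of labelled points, indexed by 0, 1, 2 *)

Section Points.
Context {D : skewFieldType} {m : nat} (b : 'M[D]_m.+3).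
Hypothesis basis_b : rbasis b.

(** A common index lets one lemma serve all three hyperplanes. Every index from 2 on yields
    [point3], hence the bounds by 3 in what follows. *)
Definition coord_point (i : nat) (g : semidirect D m) : set 'cV[D]_m.+3 :=
  match i with 0 => point1 b g | 1 => point2 b g | _ => point3 b g end.

Lemma point_hyperplane i j g : (i < 3)%N -> (j < 3)%N ->
  @coord_hyperplane D m.+2 b j (coord_point i g) <-> i = j.
Proof.
have [_ p11 p12 p13] := point1_hyperplanes b basis_b g.
have [_ p22 p21 p23] := point2_hyperplanes b basis_b g.
have [_ p33 p31 p32] := point3_hyperplanes b basis_b g.
by case: i => [|[|[|//]]] _; case: j => [|[|[|//]]] _ /=; split.
Qed.

Lemma point_proj_space i g : proj_space (coord_point i g).
Proof.
case: i => [|[|i]] /=.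
- by have [] := point1_hyperplanes b basis_b g.
- by have [] := point2_hyperplanes b basis_b g.
- by have [] := point3_hyperplanes b basis_b g.
Qed.

Lemma point_inj i j g h : (i < 3)%N -> (j < 3)%N ->
  coord_point i g = coord_point j h -> i = j /\ g = h.
Proof.
move=> i3 j3 gh; have ij : i = j.
  by apply/(point_hyperplane i j g i3 j3); rewrite gh; apply/point_hyperplane.
split=> //; move: gh; rewrite -ij; have [inj1 inj2 inj3] := points_inj b basis_b.
by case: i {i3 ij} => [/inj1|[/inj2|? /inj3]].
Qed.

(** A point on exactly one of the three hyperplanes has its two other leading coordinates nonzero:
    one is normalized to 1 or -1, the other becomes the first component of the label. *)
Lemma point_surj i p : (i < 3)%N ->
  (forall j, (j < 3)%N -> @coord_hyperplane D m.+2 b j p <-> i = j) ->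
  exists g, p = coord_point i g.
Proof.
move=> i3 pP; have := (proj2 (pP i i3) erefl) => -[x [x0 _ pE]].
have xP j : (j < 3)%N -> x (inord j) 0 = 0 <-> i = j.
  by move=> /pP; rewrite pE coord_hyperplane_hpoint.
rewrite {}pE; have [y xE] := hcoord_surj x.
have param s (z : 'cV[D]_m.+3) : s != 0 -> x = z *m s%:M ->
    @hpoint D m.+2 b x = hpoint b z.
  by move=> s0 xz; apply/hpoint_eqP => //; exists s.
case: i i3 {pP} xP => [|[|[|//]]] _ xP.
- move: xE; rewrite (proj2 (xP 0%N isT)) // => xE.
  have x1 : x (inord 1) 0 != 0 by apply/eqP => /(xP 1%N isT).
  have x2 : x (inord 2) 0 != 0 by apply/eqP => /(xP 2%N isT).
  have g0 : (x (inord 1) 0 * (x (inord 2) 0)^-1,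
             y *m ((x (inord 2) 0)^-1)%:M).1 != 0.
    by rewrite skew_mul_eq0 skew_inv_eq0 negb_or x1.
  exists (Semidirect g0); apply: (param _ _ x2).
  rewrite {1}xE hcoord_scale /= mul0r mul1r mulmx_scalarVK // -mulrA.
  by rewrite skew_mulVr // mulr1.
- move: xE; rewrite (proj2 (xP 1%N isT)) // => xE.
  have x1 : x (inord 0) 0 != 0 by apply/eqP => /(xP 0%N isT).
  have x2 : x (inord 2) 0 != 0 by apply/eqP => /(xP 2%N isT).
  have g0 : (x (inord 0) 0 * (x (inord 2) 0)^-1,
             y *m ((x (inord 2) 0)^-1)%:M).1 != 0.
    by rewrite skew_mul_eq0 skew_inv_eq0 negb_or x1.
  exists (Semidirect g0); apply: (param _ _ x2).
  rewrite {1}xE hcoord_scale /= mul0r mul1r mulmx_scalarVK // -mulrA.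
  by rewrite skew_mulVr // mulr1.
move: xE; rewrite (proj2 (xP 2%N isT)) // => xE.
have x1 : x (inord 1) 0 != 0 by apply/eqP => /(xP 1%N isT).
(* On the third hyperplane the first coordinate has to become -1, so the scale factor is its
   negative. *)
have x2 : - x (inord 0) 0 != 0 by rewrite oppr_eq0; apply/eqP => /(xP 0%N isT).
have g0 : (x (inord 1) 0 * (- x (inord 0) 0)^-1,
           y *m ((- x (inord 0) 0)^-1)%:M).1 != 0.
  by rewrite skew_mul_eq0 skew_inv_eq0 negb_or x1.
exists (Semidirect g0); apply: (param _ _ x2).
rewrite {1}xE hcoord_scale /= mul0r mulN1r opprK mulmx_scalarVK // -mulrA.
by rewrite skew_mulVr // mulr1.
Qed.

(** * From an embedded design to its group of labels *)

Section Embedding.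
Variables (n : nat) (V : set (set 'cV[D]_m.+3)) (Bl : set (set (set 'cV[D]_m.+3))).
Let H (i : nat) : set (set 'cV[D]_m.+3) := @coord_hyperplane D m.+2 b i.
Hypothesis td :
  transversal_design 3 n V [set V `&` H 0; V `&` H 1; V `&` H 2] Bl.
Hypothesis lines : forall B, Bl B -> exists2 l, line l & B `<=` l.


Lemma embedded_disjoint i j p : (i < 3)%N -> (j < 3)%N ->
  V p -> H i p -> H j p -> i = j.
Proof.
have tdr := td; rewrite set3_rot in tdr; have tdrr := tdr; rewrite set3_rot in tdrr.
have d01 := td_disjoint _ _ _ _ _ _ p td.
have d12 := td_disjoint _ _ _ _ _ _ p tdr.
have d20 := td_disjoint _ _ _ _ _ _ p tdrr.
case: i => [|[|[|//]]] _; case: j => [|[|[|//]]] _ // Vp Hi Hj.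
- by case: d01.
- by case: d20.
- by case: d01.
- by case: d12.
- by case: d20.
- by case: d12.
Qed.

Lemma embedded_point i p : (i < 3)%N -> V p -> H i p -> exists g, p = coord_point i g.
Proof.
move=> i3 Vp Hip; apply: point_surj => // j j3; split=> [Hjp|<-//].
exact: (embedded_disjoint _ _ _ i3 j3 Vp).
Qed.

(** The equation between the two lists of parts lets the same argument complete a block from any two
    of its points. *)
Lemma embedded_third i j k g h : (i < 3)%N -> (j < 3)%N -> (k < 3)%N ->
  [set V `&` H 0; V `&` H 1; V `&` H 2] = [set V `&` H i; V `&` H j; V `&` H k] ->
  V (coord_point i g) -> V (coord_point j h) ->
  exists2 f, V (coord_point k f) &
    exists l, [/\ line l, l (coord_point i g), l (coord_point j h) &
                  l (coord_point k f)].
Proof.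
move=> i3 j3 k3 ijk Vg Vh.
have tdP := td; rewrite ijk in tdP.
have Hg : (V `&` H i) (coord_point i g) by split=> //; apply/point_hyperplane.
have Hh : (V `&` H j) (coord_point j h) by split=> //; apply/point_hyperplane.
have [z [[Vz Hz] [B BB [Bx By Bz]] _]] := td_third _ _ _ _ _ _ _ _ tdP Hg Hh.
have [f zE] := embedded_point _ _ k3 Vz Hz; rewrite zE in Vz Bz.
have [l line_l Bl_l] := lines _ BB.
by exists f => //; exists l; split=> //; apply: Bl_l.
Qed.

Lemma embedded_group : (forall i, (i < 3)%N -> V (coord_point i 1%g)) ->
  exists G : set (semidirect D m),
    subgroup_of_order n G /\ forall i, (i < 3)%N -> V `&` H i = coord_point i @` G.
Proof.
move=> V1.
have perm021 : [set V `&` H 0; V `&` H 1; V `&` H 2] =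
    [set V `&` H 0; V `&` H 2; V `&` H 1] by rewrite set3_swap set3_rot.
have step01 g h : V (coord_point 0 g) -> V (coord_point 1 h) ->
    V (coord_point 2 (g * h^-1)%g).
  move=> Vg Vh; have [f Vf [l [line_l lg lh lf]]] :=
    embedded_third 0 1 2 g h isT isT isT erefl Vg Vh.
  by rewrite (line_points b basis_b _ _ _ _ line_l lg lh lf) mulgK.
have step02 g f : V (coord_point 0 g) -> V (coord_point 2 f) ->
    V (coord_point 1 (f^-1 * g)%g).
  move=> Vg Vf; have [h Vh [l [line_l lg lf lh]]] :=
    embedded_third 0 2 1 g f isT isT isT perm021 Vg Vf.
  by rewrite (line_points b basis_b _ _ _ _ line_l lg lh lf) mulKg.
have step12 h f : V (coord_point 1 h) -> V (coord_point 2 f) ->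
    V (coord_point 0 (f * h)%g).
  move=> Vh Vf; have [g Vg [l [line_l lh lf lg]]] :=
    embedded_third 1 2 0 h f isT isT isT (set3_rot _ _ _) Vh Vf.
  by rewrite -(line_points b basis_b _ _ _ _ line_l lg lh lf).
(* Setting one factor to 1 in the three inclusions above compares the first label set with each of
   the other two, in both directions. *)
have p01 g : V (coord_point 0 g) -> V (coord_point 1 g).
  by move=> Vg; rewrite -[g]mul1g -invg1; apply: step02 => //; apply: V1.
have p10 g : V (coord_point 1 g) -> V (coord_point 0 g).
  by move=> Vg; rewrite -[g]mul1g; apply: step12 => //; apply: V1.
have p02 g : V (coord_point 0 g) -> V (coord_point 2 g).
  by move=> Vg; rewrite -[g]mulg1 -invg1; apply: step01 => //; apply: V1.
have p20 g : V (coord_point 2 g) -> V (coord_point 0 g).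
  by move=> Vg; rewrite -[g]mulg1; apply: step12 => //; apply: V1.
pose G : set (semidirect D m) := [set g | V (coord_point 0 g)].
have partE i : (i < 3)%N -> V `&` H i = coord_point i @` G.
  move=> i3; apply/seteqP; split=> p.
    case=> Vp Hp; have [g pE] := embedded_point _ _ i3 Vp Hp; exists g => //.
    by move: Vp; rewrite pE /G /=; case: i i3 {Hp pE} => [|[|[|]]] //= _;
      [exact: p10|exact: p20].
  case=> g Gg <-; split; last exact/point_hyperplane.
  by case: i i3 => [|[|[|]]] //= _; [exact: p01|exact: p02].
exists G; split=> //; split; first split.
- by rewrite in_setE; exact: V1.
- by move=> g h; rewrite !in_setE => Gg Gh; apply/p20/step01 => //; exact: p01.
case: (td) => _ _ [_ _ cardP] _ _.
have /cardP : [set V `&` H 0; V `&` H 1; V `&` H 2] (V `&` H 0) by left; left.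
rewrite partE //; apply: card_eq_trans; rewrite card_eq_sym; apply: inj_card_eq.
by move=> g h _ _ /point_inj[].
Qed.

End Embedding.
End Points.

(** * Changes of coordinates *)

Section ChangeOfCoordinates.
Context {D : skewFieldType} {m : nat}.

Local Notation coords := (@hcoord D m.+2).

Lemma frame_mx_surj {k} (M : 'M[D]_(k, m.+3)) :
  exists e1 e2 e3 C, M = frame_mx e1 e2 e3 C.
Proof.
move: M; rewrite -[m.+3]/(1 + (1 + (1 + m)))%N => M.
exists (lsubmx M), (lsubmx (rsubmx M)), (lsubmx (rsubmx (rsubmx M))).
by exists (rsubmx (rsubmx (rsubmx M))); rewrite /frame_mx !hsubmxK.
Qed.

(** Zeros of each leading coordinate are preserved, so the second and third basis vectors keep their
    leading zeros and nonzero entries, and the last [m] coordinates span an invariant subspace. On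
    it [M] acts by [T], which inherits injectivity. Only vectors with first coordinate 0 are
    treated, as groups are compared through their parts on H1. *)
Lemma coord_preserving (M : 'M[D]_m.+3) : rfree M ->
  (forall i (x : 'cV[D]_m.+3), (i < 3)%N -> x != 0 ->
     (M *m x) (inord i) 0 = 0 <-> x (inord i) 0 = 0) ->
  exists (s t : D) (u v : 'cV[D]_m) (T : 'M[D]_m),
    [/\ s != 0, t != 0, GL T &
     forall (a c : D) x, M *m coords 0 a c x =
       coords 0 (s * a) (t * c) (u *m a%:M + v *m c%:M + T *m x)].
Proof.
move=> freeM MP.
have {}MP (a b c : D) x : exists a' b' c' x',
    [/\ M *m coords a b c x = coords a' b' c' x',
        a' = 0 <-> a = 0, b' = 0 <-> b = 0 & c' = 0 <-> c = 0].
  have {}MP i : (i < 3)%N ->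
      (M *m coords a b c x) (inord i) 0 = 0 <-> coords a b c x (inord i) 0 = 0.
    move=> i3; have [->|x0] := eqVneq (coords a b c x) 0; last exact: MP.
    by rewrite mulmx0.
  have [c0 c1 c2] := hcoord_coords a b c x.
  have [y yE] := hcoord_surj (M *m coords a b c x).
  do 3!eexists; exists y; split; first exact: yE.
  - by rewrite MP ?c0.
  - by rewrite MP ?c1.
  - by rewrite MP ?c2.
have [e1 [e2 [e3 [C ME]]]] := frame_mx_surj M.
have [a2 [s [c2 [u [Me2]]]]] := MP 0 1 0 0.
move=> /proj2/(_ erefl) a20 s0 /proj2/(_ erefl) c20; rewrite {}a20 {}c20 in Me2.
have [a3 [b3 [t [v [Me3]]]]] := MP 0 0 1 0.
move=> /proj2/(_ erefl) a30 /proj2/(_ erefl) b30 t0; rewrite {}a30 {}b30 in Me3.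
(* [P] projects to the last [m] coordinates, so [P *m C] is the lower right block of [M]. *)
pose P : 'M[D]_(m, m.+3) := frame_mx 0 0 0 1%:M.
have Pcoords a b c x : P *m coords a b c x = x.
  by rewrite frame_mx_hcoord !mul0mx !add0r mul1mx.
have MC x : M *m coords 0 0 0 x = coords 0 0 0 (P *m C *m x).
  have [a [b [c [y [Mx]]]]] := MP 0 0 0 x.
  move=> /proj2/(_ erefl) a0 /proj2/(_ erefl) b0 /proj2/(_ erefl) c0.
  rewrite {}a0 {}b0 {}c0 in Mx.
  have Cx : C *m x = coords 0 0 0 y.
    by rewrite -Mx ME frame_mx_hcoord !raddf0 !add0r.
  by rewrite -mulmxA Cx Pcoords Mx.
have neq0 (z : D) : (z = 0 <-> (1 : D) = 0) -> z != 0.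
  by move=> z0; apply/eqP => /(proj1 z0)/eqP; rewrite oner_eq0.
exists s, t, u, v, (P *m C); split; [exact: neq0|exact: neq0| |].
  apply: rfree_square => x Tx.
  have : M *m coords 0 0 0 x = 0 by rewrite MC Tx hcoord0.
  by move=> /freeM; rewrite -hcoord0 => /hcoord_inj[_ _ _ ->].
move=> a c x.
have -> : coords 0 a c x =
    coords 0 1 0 0 *m a%:M + coords 0 0 1 0 *m c%:M + coords 0 0 0 x.
  by rewrite !hcoord_scale !hcoordD !mul0mx !mul0r !mul1r !add0r !addr0.
rewrite 2!mulmxDr !mulmxA Me2 Me3 MC !hcoord_scale !hcoordD.
by rewrite !mul0r !add0r !addr0.
Qed.

Lemma mulmx_GL_basis (b b' : 'M[D]_m.+3) : rbasis b -> rbasis b' ->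
  exists M, rfree M /\ b' = b *m M.
Proof.
move=> basis_b basis_b'; have [B [bB _]] := rfree_square _ (proj1 basis_b).
exists (B *m b'); split; last by rewrite mulmxA bB mul1mx.
move=> x Bx; apply: (proj1 basis_b').
by rewrite -[b']mul1mx -bB -!mulmxA [B *m _]mulmxA Bx mulmx0.
Qed.

(** The base change sends (0, a, 1, x) to (0, s a, t, u a + v + T x). Dividing on the right by t
    gives the label (s, u) (a, T x) (t^-1, v t^-1). *)
Lemma point1_change_basis (b b' : 'M[D]_m.+3) : rbasis b -> rbasis b' ->
  (forall i, (i < 3)%N -> @coord_hyperplane D m.+2 b i = coord_hyperplane b' i) ->
  exists (h k : semidirect D m) (T : 'M[D]_m), GL T /\
    forall g, point1 b' g = point1 b (h * sd_phi T g * k)%g.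
Proof.
move=> basis_b basis_b' HE.
have [M [freeM b'E]] := mulmx_GL_basis _ _ basis_b basis_b'.
have [|s [t [u [v [T [s0 t0 GLT ME]]]]]] := coord_preserving M freeM.
  move=> i x i3 x0.
  have Mx0 : M *m x != 0 by apply: contra_neq x0; exact: freeM.
  have <- := coord_hyperplane_hpoint b basis_b i _ Mx0.
  have <- := coord_hyperplane_hpoint b' basis_b' i _ x0.
  by rewrite HE // /hpoint {3}b'E mulmxA.
have t1 : t^-1 != 0 by rewrite skew_inv_eq0.
pose h : semidirect D m := @Semidirect D m (s, u) s0.
pose k : semidirect D m := @Semidirect D m (t^-1, v *m (t^-1)%:M) t1.
exists h, k, T; split=> // g; rewrite /point1 /hpoint b'E -mulmxA ME.
apply/(hpoint_eqP b basis_b).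
  by rewrite hcoord_neq0 // skew_mul_eq0 negb_or s0 (sd_valP g) orbT.
exists t => //; rewrite hcoord_scale /= mul0r !mul1r mulr1 -!mulrA skew_mulVr //.
rewrite mulr1 mulmx1 -mulmxDl mulmx_scalarVK //.
by congr hcoord; rewrite -!addrA; congr (_ + _); rewrite addrC.
Qed.

Lemma part1_conj (b b' : 'M[D]_m.+3) (G1 G2 : set (semidirect D m)) :
  rbasis b -> rbasis b' ->
  (forall i, (i < 3)%N -> @coord_hyperplane D m.+2 b i = coord_hyperplane b' i) ->
  group_closed (mem G1) -> G2 1%g ->
  @part1 D m.+2 b G1 = @part1 D m.+2 b' G2 ->
  exists (g : semidirect D m) (T : 'M[D]_m),
    GL T /\ G1 = [set (g * sd_phi T h * g^-1)%g | h in G2].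
Proof.
move=> basis_b basis_b' HE [_ G1div] G21 partsE.
have [h [k [T [GLT pointE]]]] := point1_change_basis _ _ basis_b basis_b' HE.
have [inj1 _ _] := points_inj b basis_b.
have G1E x : G1 x <-> exists2 g, G2 g & x = (h * sd_phi T g * k)%g.
  split=> [G1x|[g G2g ->]].
    have : @part1 D m.+2 b G1 (point1 b x) by exists x.
    rewrite partsE => -[g G2g]; rewrite -[LHS]/(point1 b' g) pointE => /inj1 <-.
    by exists g.
  have : @part1 D m.+2 b' G2 (point1 b' g) by exists g.
  by rewrite -partsE pointE => -[y G1y /inj1 <-].
have G1V x y : G1 x -> G1 y -> G1 (x * y^-1)%g.
  by move=> G1x G1y; move: (G1div x y); rewrite !in_setE; apply.
have phi1 : sd_phi T 1%g = 1%g by apply: semidirect_eq; rewrite //= mulmx0.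
have G1hk : G1 (h * k)%g by apply/G1E; exists 1%g; rewrite // phi1 mulg1.
have conjE x : (h * x * k * (h * k)^-1)%g = (h * x * h^-1)%g.
  by rewrite invgM !mulgA mulgK.
exists h, T; split=> //; apply/seteqP; split=> x.
  move=> G1x; have : G1 (x * (h * k))%g.
    (* [G1V] gives closure under quotients only, so the product is written as a quotient by an
       inverse, which is itself the quotient of 1 = (h k) (h k)^-1 by h k. *)
    rewrite -[(h * k)%g]invgK; apply: (G1V _ _ G1x).
    by rewrite -[(h * k)^-1%g]mul1g -(mulgV (h * k)%g); do 2!apply: (G1V) => //.
  by case/G1E => g G2g xE; exists g; rewrite // -conjE -xE mulgK.
by case=> g G2g <-; rewrite -conjE; apply: G1V => //; apply/G1E; exists g.
Qed.

End ChangeOfCoordinates.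

(** * The design of a group *)

Section GroupDesign.
Context {D : skewFieldType} {m n : nat} (b : 'M[D]_m.+3).
Context (G : set (semidirect D m)).
Hypothesis basis_b : rbasis b.
Hypothesis G_group : subgroup_of_order n G.

Local Notation pt := (coord_point b).
Local Notation H := (@coord_hyperplane D m.+2 b).

Let part (i : nat) : set (set 'cV[D]_m.+3) := pt i @` G.
Let V := part 0 `|` part 1 `|` part 2.
Let P := [set part 0; part 1; part 2].
Let Bl := @collinear_triples D m.+2 b G.

(** Blocks are parametrized freely by their labels on H2 and H3; collinearity forces the label on
    H1. *)
Definition block_label (h f : semidirect D m) (i : nat) : semidirect D m :=
  match i with 0 => (f * h)%g | 1 => h | _ => f end.

Definition block (h f : semidirect D m) : set (set 'cV[D]_m.+3) :=
  [set pt 0 (f * h)%g; pt 1 h; pt 2 f].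

Let G1 : G 1%g.
Proof. by move: G_group => -[[]]; rewrite in_setE. Qed.

Let GV g h : G g -> G h -> G (g * h^-1)%g.
Proof.
by case: G_group => -[_ Gdiv] _ Gg Gh; move: (Gdiv g h); rewrite !in_setE; apply.
Qed.

Let Ginv g : G g -> G g^-1%g.
Proof. by move=> Gg; rewrite -[g^-1%g]mul1g; apply: GV. Qed.

Let GM g h : G g -> G h -> G (g * h)%g.
Proof. by move=> Gg Gh; rewrite -[h]invgK; apply/GV/Ginv. Qed.

Lemma block_point h f i g : (i < 3)%N ->
  block h f (pt i g) <-> g = block_label h f i.
Proof.
move=> i3; split=> [[[]|] /(point_inj _ basis_b)|->].
- by case=> // -> ->.
- by case=> // -> ->.
- by case=> // -> ->.
by case: i i3 => [|[|[|//]]] _; [left; left|left; right|right].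
Qed.

Lemma collinear_triplesP B :
  Bl B <-> exists h f, [/\ G h, G f & B = block h f].
Proof.
split=> [[_ [_ [_ [[g Gg <-] [h Gh <-] [f Gf <-] -> colB]]]]|[h [f [Gh Gf ->]]]].
  exists h, f; split=> //; rewrite /block /=.
  by rewrite -(proj1 (collinear_points b basis_b g h f) colB).
exists (pt 0 (f * h)%g), (pt 1 h), (pt 2 f); split.
- by exists (f * h)%g => //; exact: GM.
- by exists h.
- by exists f.
- by [].
exact/(collinear_points b basis_b).
Qed.

Lemma design_point p : V p <-> exists i g, [/\ (i < 3)%N, G g & p = pt i g].
Proof.
split=> [[[]|] [g Gg <-]|[i [g [i3 Gg ->]]]].
- by exists 0, g.
- by exists 1, g.
- by exists 2, g.
by case: i i3 => [|[|[|//]]] _; [left; left|left; right|right]; exists g.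
Qed.

Lemma design_part X : P X <-> exists2 i, (i < 3)%N & X = part i.
Proof.
split=> [[[]|] ->|[i i3 ->]]; [by exists 0|by exists 1|by exists 2|].
by case: i i3 => [|[|[|//]]] _; [left; left|left; right|right].
Qed.

Lemma part_point i j g : (i < 3)%N -> (j < 3)%N -> part i (pt j g) -> i = j /\ G g.
Proof. by move=> i3 j3 [h Gh /(point_inj _ basis_b)[]// -> <-]. Qed.

(** In the relation g = f h any two of the three labels determine the third by division in [G]: the
    multiplication table of a group is a Latin square. *)
Lemma design_block i j g h : (i < 3)%N -> (j < 3)%N -> i <> j -> G g -> G h ->
  exists h' f', [/\ G h', G f', g = block_label h' f' i /\ h = block_label h' f' j &
    forall h'' f'', g = block_label h'' f'' i -> h = block_label h'' f'' j ->
      h'' = h' /\ f'' = f'].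
Proof.
case: i => [|[|[|//]]] _; case: j => [|[|[|//]]] // _ _ Gg Gh.
- exists h, (g * h^-1)%g; split=> //=; first exact: GV; first by rewrite mulgVK.
  by move=> h'' f'' -> ->; rewrite mulgK.
- exists (h^-1 * g)%g, h; split=> //=; first exact/GM/Gg/Ginv; first by rewrite mulVKg.
  by move=> h'' f'' -> ->; rewrite mulKg.
- exists g, (h * g^-1)%g; split=> //=; first exact: GV; first by rewrite mulgVK.
  by move=> h'' f'' -> ->; rewrite mulgK.
- by exists g, h; split=> //= h'' f'' -> ->.
- exists (g^-1 * h)%g, g; split=> //=; first exact/GM/Gh/Ginv; first by rewrite mulVKg.
  by move=> h'' f'' -> ->; rewrite mulKg.
- by exists h, g; split=> //= h'' f'' -> ->.
Qed.

Lemma group_design : (3 <= n)%N -> transversal_design 3 n V P Bl.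
Proof.
move=> n3.
have partI i j : (i < 3)%N -> (j < 3)%N -> part i = part j -> i = j.
  move=> i3 j3 ij; have : part i (pt i 1%g) by exists 1%g.
  by rewrite ij => /part_point[].
split.
- by [].
- rewrite (_ : V = (fun u => pt u.1 u.2) @` (`I_3 `*` G)).
    apply: (card_eq_trans _ (setX_I_card G 3 n (proj2 G_group))).
    apply: inj_card_eq => -[i g] [j h]; rewrite !in_setE => -[/= i3 _] [/= j3 _].
    by case/(point_inj _ basis_b) => // -> ->.
  apply/seteqP; split=> [p /design_point[i [g [i3 Gg ->]]]|_ [[i g] [/= i3 Gg] <-]].
    by exists (i, g).
  by apply/design_point; exists i, g.
- split.
  + split.
    * apply/seteqP; split=> p.
        by case=> X /design_part[i i3 ->] [g Gg <-]; apply/design_point; exists i, g.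
      case/design_point=> i [g [i3 Gg ->]].
      by exists (part i); [apply/design_part; exists i | exists g].
    * move=> _ _ /design_part[i i3 ->] /design_part[j j3 ->] [_ [[g Gg <-]]].
      by move/part_point => -[]// ->.
    * by move=> _ /design_part[i i3 ->]; exists (pt i 1%g), 1%g.
  + by apply: set3_card => /partI; [move/(_ isT isT)..].
  + move=> _ /design_part[i i3 ->]; apply: (card_eq_trans _ (proj2 G_group)).
    by apply: inj_card_eq => g h _ _ /(point_inj _ basis_b)[].
- move=> B /collinear_triplesP[h [f [Gh Gf ->]]]; split.
    move=> p [[]|] ->; apply/design_point.
    + by exists 0, (f * h)%g; split=> //; exact: GM.
    + by exists 1, h.
    + by exists 2, f.
  by apply: set3_card => /(point_inj _ basis_b)[].
move=> x y /design_point[i [g [i3 Gg ->]]] /design_point[j [h [j3 Gh ->]]] xy.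
have [ij|/eqP ij] := eqVneq i j; [left|right].
  rewrite -ij in xy *; split.
    exists (part i); split.
      by split; [apply/design_part; exists i|exists g|exists h].
    by move=> _ [/design_part[k k3 ->] /part_point[]// ->].
  case=> B [/collinear_triplesP[h' [f' [_ _ ->]]]].
  move=> /(proj1 (block_point _ _ _ _ i3)) gE /(proj1 (block_point _ _ _ _ i3)) hE.
  by apply: xy; rewrite gE hE.
have [h' [f' [Gh' Gf' [gE hE] uniq]]] := design_block i j g h i3 j3 ij Gg Gh.
split.
  exists (block h' f'); split.
    split; [|exact/block_point..].
    by apply/collinear_triplesP; exists h', f'.
  move=> _ [/collinear_triplesP[h'' [f'' [_ _ ->]]]].
  move=> /(proj1 (block_point _ _ _ _ i3)) g_ /(proj1 (block_point _ _ _ _ j3)) h_.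
  by have [-> ->] := uniq _ _ g_ h_.
case=> _ [/design_part[k k3 ->] /part_point[]// ki _ /part_point[]// kj _].
by apply: ij; rewrite -ki.
Qed.

Lemma group_design_lies_on : lies_on V P Bl (H 0) (H 1) (H 2).
Proof.
have partE i : (i < 3)%N -> part i = V `&` H i.
  move=> i3; apply/seteqP; split=> p.
    case=> g Gg <-; split; first by apply/design_point; exists i, g.
    exact/point_hyperplane.
  case=> /design_point[j [g [j3 Gg ->]]] /(point_hyperplane _ basis_b) <- //.
  by exists g.
have H_neq i j : (i < 3)%N -> (j < 3)%N -> i <> j -> H i <> H j.
  move=> i3 j3 ij Hij; apply: ij; apply/(point_hyperplane _ basis_b i j 1%g) => //.
  by rewrite -Hij; apply/point_hyperplane.
split.
- by move=> p /design_point[i [g [_ _ ->]]]; exact: point_proj_space.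
- by split; exact: coord_hyperplane_hyperplane.
- by split; exact: H_neq.
- by rewrite -!partE.
have /choice[l lP] : forall B, exists l, Bl B -> @line D m.+2 l /\ B `<=` l.
  (* The default [set0] is assigned to sets that are not blocks. *)
  move=> B; have [[_ [_ [_ [_ _ _ _ [l]]]]]|nB] := pselect (Bl B); last by exists set0.
  by exists l.
have block_sub h f i : (i < 3)%N -> Bl (block h f) ->
    l (block h f) (pt i (block_label h f i)).
  by move=> i3 /lP[_]; apply; apply/block_point.
exists l; split.
  move=> B B'; rewrite !in_setE => BB BB'.
  case/collinear_triplesP: (BB) => h [f [_ _ BE]].
  case/collinear_triplesP: (BB') => h' [f' [_ _ BE']].
  rewrite {}BE in BB *; rewrite {}BE' in BB' * => ll.
  have [line_l _] := lP _ BB.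
  have l0 := block_sub h f 0 isT BB; have l1 := block_sub h f 1 isT BB.
  have := block_sub h' f' 1 isT BB'; have := block_sub h' f' 2 isT BB'.
  rewrite -ll => l2' l1'; have l2 := block_sub h f 2 isT BB.
  (* If two blocks span the same line, exchanging one point of the first for that of the second
     keeps the triple collinear; this gives f h = f' h, and likewise f h = f h'. *)
  have /= ff' := line_points b basis_b _ _ _ _ line_l l0 l1 l2'.
  have /= hh' := line_points b basis_b _ _ _ _ line_l l0 l1' l2.
  by rewrite (mulIg _ _ _ ff') (mulgI _ _ _ hh').
move=> B BB; have [line_l Bl_l] := lP _ BB; split=> //.
case/collinear_triplesP: (BB) => h [f [_ _ BE]]; rewrite {}BE in BB line_l Bl_l *.
have notin i j : (i < 3)%N -> (j < 3)%N -> i <> j -> ~ (l (block h f) `<=` H i).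
  move=> i3 j3 ij lH; apply: ij.
  (* The line contains the point of the block on [H j], which is not on [H i]. *)
  by have /lH/(point_hyperplane _ basis_b)-> := block_sub h f j j3 BB.
by split; [exact: (notin 0 1)|exact: (notin 1 0)|exact: (notin 2 0)].
Qed.

End GroupDesign.

Theorem proposition13 (D : skewFieldType) (d n : nat) (hd : (2 <= d)%N) :
  (forall (V : set (set 'cV[D]_d.+1)) (P Bl : set (set (set 'cV[D]_d.+1)))
      (H1 H2 H3 : set (set 'cV[D]_d.+1)),
    transversal_design 3 n V P Bl ->
    lies_on V P Bl H1 H2 H3 ->
    flat (d%:Z - 3) (H1 `&` H2 `&` H3) ->
    [/\ forall p1 p2, (H1 `&` V) p1 -> (H2 `&` V) p2 ->
          (exists! p3, third_point V Bl H3 p1 p2 p3) /\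
          (forall p3, third_point V Bl H3 p1 p2 p3 ->
             exists b, adapted_coordinates H1 H2 H3 p1 p2 p3 b),
        forall b, coordinate_choice V Bl H1 H2 H3 b ->
          exists! G, parametrizes n V H1 H2 H3 b G &
        forall b b' G1 G2,
          coordinate_choice V Bl H1 H2 H3 b ->
          coordinate_choice V Bl H1 H2 H3 b' ->
          parametrizes n V H1 H2 H3 b G1 ->
          parametrizes n V H1 H2 H3 b' G2 ->
          exists (g : semidirect D d.-2) (T : 'M[D]_d.-2),
            GL T /\ G1 = [set (g * sd_phi T h * g^-1)%g | h in G2]]) /\
  (forall (b : 'M[D]_d.+1) (G : set (semidirect D d.-2)),
    rbasis b -> (3 <= n)%N -> subgroup_of_order n G ->
    let V := part1 b G `|` part2 b G `|` part3 b G in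
    let P := [set part1 b G; part2 b G; part3 b G] in
    let Bl := collinear_triples b G in
    transversal_design 3 n V P Bl /\
    lies_on V P Bl
      (coord_hyperplane b 0) (coord_hyperplane b 1) (coord_hyperplane b 2)).
Proof.
case: d hd => [|[|m]] // _; split=> [V P Bl H1 H2 H3 td|b G basis_b n3 G_group V P Bl].
  case=> _ [hyp1 hyp2 hyp3] _ PE [l [_ lB]] capH; subst P.
  have tdr := td; rewrite set3_rot in tdr; have tdrr := tdr; rewrite set3_rot in tdrr.
  have lines B : Bl B -> exists2 l0, line l0 & B `<=` l0.
    by move=> /lB[line_l Bl_l _]; exists (l B).
  have n12 p : V p -> H1 p -> ~ H2 p.
    by move=> Vp H1p H2p; apply: (td_disjoint _ _ _ _ _ _ p td).
  have n23 p : V p -> H2 p -> ~ H3 p.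
    by move=> Vp H2p H3p; apply: (td_disjoint _ _ _ _ _ _ p tdr).
  have n31 p : V p -> H3 p -> ~ H1 p.
    by move=> Vp H3p H1p; apply: (td_disjoint _ _ _ _ _ _ p tdrr).
  split=> [p1 p2 [H1p1 Vp1] [H2p2 Vp2]|b|b b' G1 G2].
  - split.
      have [||p3 [[Vp3 H3p3] [B BB [Bp1 Bp2 Bp3]] p3_uniq]] :=
        td_third _ _ _ _ _ _ p1 p2 td; [by []|by []|].
      exists p3; split; first by split=> //; exists B.
      by move=> p [[H3p Vp] [B' BB' [B'p1 B'p2 B'p]]]; rewrite (p3_uniq p B').
    move=> p3 [[H3p3 Vp3] [B /lines[l0 line_l0 Bl0] [Bp1 Bp2 Bp3]]].
    apply: (adapted_coordinates_exist H1 H2 H3 p1 p2 p3 l0) => //.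
    + exact: n12.
    + by move=> H3p1; apply: (n31 p1).
    + by move=> H1p2; apply: (n12 p2).
    + exact: n23.
    + exact: Bl0.
    + exact: Bl0.
    + exact: Bl0.
  - case=> p1 [p2 [p3 [[_ Vp1] [_ Vp2] [[_ Vp3] _] [basis_b]]]].
    move=> [p1E p2E p3E] [H1E H2E H3E]; subst H1 H2 H3.
    have [|G [G_group GE]] := embedded_group b basis_b n V Bl td lines.
      (* The chosen points are exactly those with label (1, 0), the unit of the group. *)
      by case=> [|[|[|//]]] _; rewrite /= /point1 /point2 /point3 -?p1E -?p2E -?p3E.
    exists G; split.
      split=> //; rewrite !(setIC _ V).
      by split; [exact: (GE 0%N)|exact: (GE 1%N)|exact: (GE 2%N)].
    (* Uniqueness: injectivity of [point1] recovers the group from the part on H1 alone. *)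
    move=> G' [_ [part1E _ _]]; have [inj1 _ _] := points_inj b basis_b.
    have inP (S : set (semidirect D m)) g :
        @part1 D m.+2 b S (point1 b g) <-> S g.
      by split=> [[h Sh /inj1<-]|Sg] //; exists g.
    have partsE : @part1 D m.+2 b G = @part1 D m.+2 b G'.
      by rewrite -part1E setIC; exact/esym/(GE 0%N).
    by apply/seteqP; split=> g /inP Gg; apply/inP; move: Gg; rewrite partsE.
  case=> p1 [p2 [p3 [_ _ _ [basis_b _ [H1E H2E H3E]]]]].
  case=> p1' [p2' [p3' [_ _ _ [basis_b' _ [H1E' H2E' H3E']]]]].
  move=> [[G1_closed _] [part1E _ _]] [[G2_closed _] [part1E' _ _]].
  apply: (part1_conj b b') => //.
  + by case=> [|[|[|//]]] _; [rewrite -H1E|rewrite -H2E|rewrite -H3E].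
  + by case: G2_closed; rewrite in_setE.
  + by rewrite -part1E.
split; first exact: group_design.
exact: (group_design_lies_on (n := n)).
Qed.
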